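(* Let $m\ge2$ be an integer. Assume that, for every $1\le i\le m$, the sequence $\{\phi_{m,n}^{i}\}_{n\ge1}$ converges uniformly on $[0,1]$ to a function $Y_m^i$ that is continuous on $[0,1]$ and differentiable on $(0,1]$, and that the sequence $\{\theta_{m,n}^{i}\}_{n\ge1}$ converges uniformly on $[0,1]$ to a function that is continuous and differentiable on $[0,1)$. Let $\vartheta_m$ be the (unique) solution in $[0,1]$ of the equation $Y_m^m(x)=x$, and let $$\pi_m(x):=\sum_{i=1}^{m}Y_m^{i}(x)\,z_m^{i}(x).$$ Then $$\lim_{n\to\infty}\mathbf{P}_n^m=\pi_m(\vartheta_m).$$
   Context: Multi-returning secretary problem: there are $n$ candidates with a strict total ranking, and each candidate has $m$ identical copies, so there are $mn$ objects. The objects are inspected one by one in uniformly random order (all $(mn)!$ orders equally likely). When an object is inspected we learn which already inspected candidate it is a copy of (if any) and how its candidate ranks relative to all candidates inspected so far, and we must immediately accept it (the process ends) or reject it irrevocably. Success means accepting a copy of the best of the $n$ candidates. A strategy decides using only the information available so far; it is optimal if it maximizes the probability of success. $\mathbf{P}_n^m$ denotes the probability of success under an optimal strategy. At any moment the maximal candidate is the best among the candidates inspected so far. An inspected object is a nice candidate if it is the $m$-th (last) copy to appear of the candidate that is maximal at that moment. The process is in state $(k,i)$ if all objects inspected so far have been rejected, exactly $k$ different candidates have been inspected, and exactly $i$ copies of the maximal candidate among them have been inspected. For $1\le k\le n$ and $1\le i\le m$: $\Phi_{m,n}^{i}(k)$ is the probability of success when, starting from state $(k,i)$, one accepts the first nice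 candidate inspected from then on; $\Theta_{m,n}^{i}(k)$ is the probability that, when all objects are rejected, at the moment the $k$-th different candidate is inspected for the first time (that inspection included), exactly $i$ copies of the best of the $k$ candidates inspected so far have been inspected. For $x\in[0,1]$, $\phi_{m,n}^{i}(x):=\Phi_{m,n}^{i}(\lfloor xn\rfloor)$ and $\theta_{m,n}^{i}(x):=\Theta_{m,n}^{i}(\lfloor xn\rfloor)$, with the convention that the values of $\Phi_{m,n}^i,\Theta_{m,n}^i$ at $0$ are those at $1$. In the paper the functions $y_i=Y_m^i$ are denoted as the solutions on $(0,1]$ of the following system with $y_i(1)=1$ for $1\le i\le m-1$ and $y_m(1)=0$ (which the uniform limits of $\phi_{m,n}^i$ satisfy): $$\begin{cases} (m-mx)\,y_1'=(m-1)y_1-(m-1)y_2 & (\text{if } m\ge3),\\ (mx-mx^2)\,y_i'=m(x-1)y_1+(m-ix)y_i-x(m-i)y_{i+1}, & 2\le i\le m-2,\\ (mx-mx^2)\,y_{m-1}'=-(m-mx)y_1+(m-(m-1)x)y_{m-1}-x^2,\\ x\,y_m'=-y_1+y_m. \end{cases}$$ The functions $z_m^i$ are: $z_m^1(0)=1$, $z_m^i(0)=0$ for $2\le i\le m$, and for $x\in(0,1]$ (values at $x=1$ understood as limits $x\to1^-$) $$z_m^{1}(x)=\frac{m\left(-1+(1-x)^{-1/m}\right)(1-x)}{x},\qquad z_m^{2}(x)=\frac{m(m-1)\left(-1+(1-x)^{1/m}\right)^{2}(1-x)^{\frac{m-2}{m}}}{2x},$$ $$z_m^{i}(x)=\frac{m!\left((-1)^{i}\left(-1+(1-x)^{1/m}\right)\right)^{i}(1-x)^{\frac{m-i}{m}}}{i!\,x\,(m-i)!}\quad(3\le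 i\le m).$$ *)

(* Defs.v *)
From HB Require Import structures.
From mathcomp Require Import all_boot all_order all_fingroup all_algebra.
From mathcomp Require Import all_classical all_reals all_analysis.
Import Order.TTheory GRing.Theory Num.Theory.
Import numFieldNormedType.Exports.

Set Implicit Arguments.
Unset Strict Implicit.
Unset Printing Implicit Defensive.

Local Open Scope ring_scope.
Local Open Scope classical_set_scope.

(* The m * n objects are the elements of 'I_(m * n), and object a is a copy of
   candidate a %/ m.  Candidates are numbered 0, ..., n - 1 from worst to best.
   An inspection order is w : 'S_(m * n), and w t is the object inspected at
   time t (times start at 0). *)
Definition cand (m n : nat) (w : 'S_(m * n)) (t : 'I_(m * n)) : nat :=
  (w t %/ m)%N.

Definition is_best (n c : nat) : bool := c.+1 == n.

Definition Pr (R : realType) (T : finType) (A : pred T) : R :=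
  #|A|%:R / #|T|%:R.

Definition cPr (R : realType) (T : finType) (A B : pred T) : R :=
  Pr R [pred w | A w && B w] / Pr R B.

(* The orders w and w' cannot be told apart after the inspection at time t: the
   same inspected objects are copies of the same candidate (<= in both
   directions) and the inspected candidates are ranked in the same way. *)
Definition same_info (m n : nat) (t : 'I_(m * n)) (w w' : 'S_(m * n)) : bool :=
  [forall a : 'I_(m * n), forall b : 'I_(m * n),
     ((a <= t) && (b <= t))%N ==>
       ((cand w a <= cand w b)%N == (cand w' a <= cand w' b)%N)].

(* d (t, w) = true: given the order w, accept the object inspected at time t if
   all earlier objects were rejected. *)
Definition decision (m n : nat) := {ffun 'I_(m * n) * 'S_(m * n) -> bool}.

Definition strategy (m n : nat) (d : decision m n) : bool :=
  [forall t, forall w, forall w',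
     same_info t w w' ==> (d (t, w) == d (t, w'))].

Definition success (m n : nat) (d : decision m n) (w : 'S_(m * n)) : bool :=
  [exists t : 'I_(m * n),
     [&& d (t, w),
         [forall u : 'I_(m * n), (u < t)%N ==> ~~ d (u, w)] &
         is_best n (cand w t)]].

Definition optimal_success (R : realType) (m n : nat) : R :=
  \big[Num.max/0]_(d : decision m n | strategy d) Pr R (success d).

(* The candidates of the objects inspected at times 0, ..., t - 1. *)
Definition inspected (m n : nat) (w : 'S_(m * n)) (t : nat) : seq nat :=
  take t [seq cand w j | j <- enum 'I_(m * n)].

Definition maximal (s : seq nat) : nat := \max_(c <- s) c.

Definition ndifferent (s : seq nat) : nat := size (undup s).

Definition ncopies_max (s : seq nat) : nat := count_mem (maximal s) s.

(* State (k, i), for k >= 1; that all objects of s have been rejected is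
   implicit in the uses below. *)
Definition in_state (k i : nat) (s : seq nat) : bool :=
  (ndifferent s == k) && (ncopies_max s == i).

(* The object inspected at time t is a nice candidate. *)
Definition nice (m n : nat) (w : 'S_(m * n)) (t : 'I_(m * n)) : bool :=
  (cand w t == maximal (inspected w t.+1)) &&
  (ncopies_max (inspected w t.+1) == m).

(* After t inspections, accepting the first nice candidate inspected from then
   on yields a copy of the best candidate. *)
Definition first_nice_success (m n : nat) (w : 'S_(m * n)) (t : nat) : bool :=
  [exists u : 'I_(m * n),
     [&& (t <= u)%N, nice w u,
         [forall v : 'I_(m * n), (t <= v < u)%N ==> ~~ nice w v] &
         is_best n (cand w u)]].

(* The process, all objects being rejected, enters state (k, i) with the t-th
   inspection. *)
Definition enters (m n : nat) (k i : nat) (w : 'S_(m * n)) (t : nat) : bool :=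
  in_state k i (inspected w t) &&
  [forall u : 'I_t, ~~ in_state k i (inspected w u)].

(* Conditional probability given that state (k, i) is visited, counted from the
   moment it is entered.  The process is Markovian, so conditioning on being in
   state (k, i) after any fixed number of inspections gives the same value. *)
Definition Phi (R : realType) (m n i k : nat) : R :=
  cPr R
    [pred w : 'S_(m * n) |
       [exists t : 'I_(m * n).+1, enters k i w t && first_nice_success w t]]
    [pred w : 'S_(m * n) | [exists t : 'I_(m * n).+1, enters k i w t]].

Definition Theta (R : realType) (m n i k : nat) : R :=
  Pr R
    [pred w : 'S_(m * n) |
       [exists t : 'I_(m * n),
          (cand w t \notin inspected w t) &&
          in_state k i (inspected w t.+1)]].

(* For x in [0, 1]; the value at floor (x n) = 0 is the one at 1. *)
Definition scaled (R : realType) (f : nat -> R) (n : nat) (x : R) : R :=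
  f (maxn 1 (Num.truncn (x * n%:R))).

Definition phi (R : realType) (m i n : nat) : R -> R := scaled (Phi R m n i) n.

Definition theta (R : realType) (m i n : nat) : R -> R :=
  scaled (Theta R m n i) n.

(* Differentiability on A, one-sided at the endpoints belonging to A when A is
   an interval. *)
Definition differentiable_on (R : realType) (A : set R) (f : R -> R) : Prop :=
  forall x, A x -> cvg ((f y - f x) / (y - x) @[y --> within A x^']).

(* At x = 1 the formulas below take the values of their limits at 1, because
   0 `^ 0 = 1 and 0 `^ a = 0 for a != 0. *)
Definition z (R : realType) (m i : nat) (x : R) : R :=
  if x == 0 then (i == 1)%N%:R
  else if i == 1%N then
    m%:R * (-1 + (1 - x) `^ (- m%:R^-1)) * (1 - x) / x
  else if i == 2%N then
    m%:R * (m%:R - 1) * (-1 + (1 - x) `^ m%:R^-1) ^+ 2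
      * (1 - x) `^ ((m%:R - 2) / m%:R) / (2 * x)
  else
    m`!%:R * ((-1) ^+ i * (-1 + (1 - x) `^ m%:R^-1)) ^+ i
      * (1 - x) `^ ((m%:R - i%:R) / m%:R) / (i`!%:R * x * (m - i)`!%:R).

Definition pi_sum (R : realType) (m : nat) (Y : nat -> R -> R) (x : R) : R :=
  \sum_(1 <= i < m.+1) Y i x * z m i x.

(* Main.v *)
Require Import Defs.
From mathcomp Require Import all_boot all_order all_fingroup all_algebra.
From mathcomp Require Import all_classical all_reals all_analysis.
From mathcomp Require Import ring lra zify.
Import Order.TTheory GRing.Theory Num.Theory.
Import numFieldNormedType.Exports.
Local Open Scope ring_scope.
Local Open Scope classical_set_scope.

Set Implicit Arguments.
Unset Strict Implicit.
Unset Printing Implicit Defensive.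

(* The information pattern only matters through k (number of different
   candidates inspected) and r = m - i (copies of the maximal candidate still
   to come).  Two symmetries of the uniform order give the transition
   probabilities given the visible information: permuting the future objects,
   and exchanging the consecutive candidates c and c.+1, which is invisible
   unless both have been inspected.  The latter yields that the best candidate
   is among the k inspected ones with probability k / n.

   Rejecting a copy of the maximal candidate never hurts while another copy is
   to come, so only nice candidates are accepted.  The value F k 0 of waiting at
   level k satisfies F k 0 / k = F k.+1 0 / k.+1 + F k.+1 m.-1 / (k * k.+1),
   hence F k 0 / k decreases and the optimal rule has a threshold K, the first
   k with F k 0 <= k / n.  The same identity makes x |-> Y m x / x strictly
   decreasing, so that Y m x = x has one solution vartheta, and K / n tends to
   it.

   Before K the value function is harmonic for the chain (k, r).  The functions
   affine in 'C(r, q), q < m, diagonalise this chain, so the law of r on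
   reaching level K is explicit: products of (n - j) / (n - j + q / m), which
   tend to (1 - vartheta) `^ (q / m), and binomial inversion gives z. *)

(** * The Markov chain of levels and remaining copies *)

Section Balance.
Context {R : realFieldType}.
Implicit Types (m n k r : nat) (W : nat -> nat -> R).

(** A new candidate has a uniform rank among the [k.+1] inspected ones: with probability 1 / (k + 1)
    it becomes maximal, with [m.-1] copies to come; otherwise [r] is unchanged. *)
Definition new_candidate_mean m W k r : R := (k%:R * W k.+1 r + W k.+1 m.-1) / k.+1%:R.

(** At [r = 1] the next copy of the maximal candidate is its last one, hence nice, and earns [x]
    instead of a value of [W]. At [r = 0] the index [r.-1] is a dummy with weight 0; for [k = n] the
    equation is then void, which is why [balanced] fixes [W n 0] separately. *)
Definition balanced_at m n (x : R) k W : Prop :=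
  forall r, (r < m)%N ->
    r%:R * (if r == 1%N then x else W k r.-1)
      + m%:R * (n%:R - k%:R) * new_candidate_mean m W k r
    = (r%:R + m%:R * (n%:R - k%:R)) * W k r.

(* Here W k r is a value in state (k, m - r) and X k the reward for reaching a
   nice candidate at level k.  The weights r and m * (n - k) count the objects
   that change the state: copies of the maximal candidate and of new ones. *)
Definition balanced m n (X : nat -> R) W : Prop :=
  W n 0%N = 0 /\ forall k, (1 <= k <= n)%N -> balanced_at m n (X k) k W.

(** Solves the equation of one level upwards in [r], with [c] standing for the means over the next
    level. The reward is [b (c 0)] because [c 0] is the value at [r = 0]. *)
Fixpoint level (m n k : nat) (b : R -> R) (c : nat -> R) (r : nat) : R :=
  if r is r'.+1 then
    (r%:R * (if r' == 0%N then b (c 0%N) else level m n k b c r')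
       + m%:R * (n%:R - k%:R) * c r) / (r%:R + m%:R * (n%:R - k%:R))
  else c 0%N.

Fixpoint value_from m n (b : nat -> R -> R) (j : nat) : nat -> R :=
  if j is j'.+1 then
    level m n (n - j) (b (n - j)%N)
      (new_candidate_mean m (fun=> value_from m n b j') (n - j))
  else level m n n (b n) (fun=> 0).

Definition value m n (b : nat -> R -> R) k : nat -> R :=
  value_from m n b (n - k).

Lemma balanced_value m n b : (0 < m)%N ->
  balanced m n (fun k => b k (value m n b k 0%N)) (value m n b).
Proof.
move=> m0; split=> [|k /andP[k1 kn] r rm]; first by rewrite /value subnn.
(* At [k = n] the mean refers to a fictitious level n + 1; its factor n - k vanishes, so the zero
   function may replace it. *)
have [c [vE cE]] : exists c, value m n b k = level m n k (b k) c /\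
    forall r, (n%:R - k%:R) * c r = (n%:R - k%:R) * new_candidate_mean m (value m n b) k r :> R.
  have [{}kn|nk] := ltnP k n; last first.
    have -> : k = n by lia.
    by exists (fun=> 0); rewrite /value subnn; split=> // ?; rewrite subrr !mul0r.
  exists (new_candidate_mean m (value m n b) k); split => //.
  rewrite /value -(subnSK kn) /=; have -> : (n - (n - k.+1).+1 = k)%N by lia.
  by [].
rewrite -mulrA -cE mulrA vE; case: r rm => [|r] rm /=.
  by rewrite mul0r !add0r.
rewrite eqSS.
have dpos : 0 < r.+1%:R + m%:R * (n%:R - k%:R) :> R.
  apply: ltr_wpDr; last by rewrite ltr0n.
  by rewrite mulr_ge0 ?ler0n // subr_ge0 ler_nat.
by rewrite [RHS]mulrC divfK ?lt0r_neq0.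
Qed.

Lemma balanced_at0 m n x k W : (k < n)%N -> (0 < m)%N ->
  balanced_at m n x k W -> W k 0%N = new_candidate_mean m W k 0.
Proof.
move=> kn m0 /(_ 0%N m0) /=; rewrite mul0r !add0r => /mulfI -> //.
by rewrite mulf_neq0 // ?pnatr_eq0 -?lt0n // subr_eq0 eqr_nat; lia.
Qed.

(** For [r > 0] the equation determines [W k r] from [W k r.-1] and the next level. The value
    [W k 0] has to be given, since the equation leaves it free at [k = n]. *)
Lemma balanced_at_eq m n x k W W' : (k <= n)%N -> (0 < m)%N ->
    balanced_at m n x k W -> balanced_at m n x k W' ->
    W k 0%N = W' k 0%N ->
    ((k < n)%N -> forall r, (r < m)%N -> W k.+1 r = W' k.+1 r) ->
  forall r, (r < m)%N -> W k r = W' k r.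
Proof.
move=> kn m0 bW bW' e0 eS; elim=> [//|r IH] rm.
have dpos : 0 < r.+1%:R + m%:R * (n%:R - k%:R) :> R.
  apply: ltr_wpDr; last by rewrite ltr0n.
  by rewrite mulr_ge0 ?ler0n // subr_ge0 ler_nat.
apply: (mulfI (lt0r_neq0 dpos)); rewrite -bW // -bW' //= eqSS IH; last lia.
congr (_ + _); have [{}kn|nk] := ltnP k n; last first.
  have {}nk : k = n by lia.
  by rewrite nk subrr mulr0 !mul0r.
by rewrite /new_candidate_mean !eS //; lia.
Qed.

(** * Lower bounds for balanced values *)

Section Bounds.
Context (m n : nat) (X : nat -> R) (W : nat -> nat -> R).
Hypotheses (m2 : (2 <= m)%N) (n1 : (1 <= n)%N) (bW : balanced m n X W).
Hypothesis X_ge : forall k, (1 <= k <= n)%N -> k%:R / n%:R <= X k.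

Lemma balanced0 k : (1 <= k < n)%N ->
  k.+1%:R * W k 0%N = k%:R * W k.+1 0%N + W k.+1 m.-1.
Proof.
move=> kn; rewrite (@balanced_at0 m n (X k) k W) ?(ltnW m2) //; last first.
- by apply: bW.2; lia.
- by lia.
by rewrite /new_candidate_mean mulrC divfK // pnatr_eq0.
Qed.

(** [W k r.+1] is a weighted mean of the two quantities bounded below by [c]; for [k = n] the second
    one has weight 0. *)
Lemma balancedS_ge k r c : (1 <= k <= n)%N -> (r.+1 < m)%N ->
    c <= (if r == 0%N then X k else W k r) ->
    ((k < n)%N -> c <= new_candidate_mean m W k r.+1) ->
  c <= W k r.+1.
Proof.
move=> kn rm cX cm; have N0 : 0 <= m%:R * (n%:R - k%:R) :> R.
  by rewrite mulr_ge0 ?ler0n // subr_ge0 ler_nat; lia.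
have dpos : 0 < r.+1%:R + m%:R * (n%:R - k%:R) :> R.
  by apply: ltr_wpDr => //; rewrite ltr0n.
rewrite -(ler_pM2l dpos) -bW.2 //= eqSS mulrDl lerD //.
  by rewrite ler_pM2l ?ltr0n.
have [kn'|nk] := ltnP k n; first by rewrite ler_wpM2l // cm.
have {}nk : k = n by lia.
by rewrite nk subrr mulr0 !mul0r.
Qed.

(** With copies to come, the last copy pays [X k], and any new candidate leads to level k + 1 again
    with copies to come, worth at least (k + 1) / n. This is what rules out accepting a copy that is
    not the last. *)
Lemma balanced_ge k r : (1 <= k <= n)%N -> (r < m)%N ->
  (0 < r)%N%:R * (k%:R / n%:R) <= W k r.
Proof.
have [j] := ubnP (n - k)%N; elim: j k r => // j IH k r jn kn.
have W0 : 0 <= W k 0%N.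
  have [kn'|nk] := ltnP k n; last by have -> : k = n; [lia|rewrite bW.1].
  have k1 : 0 < k.+1%:R :> R by rewrite ltr0n.
  rewrite -(pmulr_rge0 _ k1) balanced0; last lia.
  apply: addr_ge0; first (apply: mulr_ge0 => //; apply: le_trans (IH k.+1 0%N _ _ _); try lia).
    by rewrite mul0r.
  apply: le_trans (IH k.+1 m.-1 _ _ _); try lia.
  by rewrite mulr_ge0 // divr_ge0.
have nR : 0 < n%:R :> R by rewrite ltr0n.
elim: r => [|r IHr] rm; first by rewrite mul0r.
rewrite mul1r; apply: balancedS_ge => //.
  case: eqP => [_|/eqP r0]; first exact: X_ge.
  by apply: le_trans (IHr _); rewrite ?lt0n ?r0 ?mul1r //; lia.
move=> kn'; rewrite /new_candidate_mean ler_pdivlMr ?ltr0n //.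
have := IH k.+1 r.+1 ltac:(lia) ltac:(lia) rm.
have := IH k.+1 m.-1 ltac:(lia) ltac:(lia) ltac:(lia).
have -> : (0 < m.-1)%N by lia.
rewrite !mul1r -natr1 => A B.
have C : 0 <= (k%:R + 1) / n%:R :> R by rewrite divr_ge0 // addr_ge0.
have : k%:R * ((k%:R + 1) / n%:R) <= k%:R * W k.+1 r.+1 :> R by rewrite ler_wpM2l.
have -> : k%:R / n%:R * (k%:R + 1) = k%:R * ((k%:R + 1) / n%:R) :> R by ring.
lra.
Qed.

Lemma balanced_ge0 k r : (1 <= k <= n)%N -> (r < m)%N -> 0 <= W k r.
Proof.
move=> kn rm; apply: le_trans (@balanced_ge k r kn rm).
by rewrite mulr_ge0 // divr_ge0.
Qed.

(** By [balanced0] the ratio drops from j to j + 1 by [W j.+1 m.-1] / (j (j + 1)), which is at least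
    1 / (j n) >= 1 / (l n) by [balanced_ge]. An explicit amount is kept so that the decrease stays
    strict in the limit. *)
Lemma exhausted_ratio_drop k l : (1 <= k)%N -> (k <= l <= n)%N ->
  (l%:R - k%:R) / (l%:R * n%:R) <= W k 0%N / k%:R - W l 0%N / l%:R.
Proof.
move=> k1; have nR : 0 < n%:R :> R by rewrite ltr0n.
elim: l => [|l IH] kl; first lia.
have [<-|{}kl] : k = l.+1 \/ (k <= l < n)%N by lia.
  by rewrite !subrr mul0r.
have l0 : 0 < l%:R :> R by rewrite ltr0n; lia.
have k0 : 0 < k%:R :> R by rewrite ltr0n.
have l1 : 0 < l%:R + 1 :> R by rewrite ltr_wpDl // ltW.
have /= := @balanced_ge l.+1 m.-1 ltac:(lia) ltac:(lia).
have -> : (0 < m.-1)%N by lia.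
rewrite mul1r => G.
have E := @balanced0 l ltac:(lia).
move: G E (IH ltac:(lia)); rewrite -natr1.
set a := W l.+1 m.-1; set u := W l.+1 _; set v := W l _ => G E.
have -> : v = (l%:R * u + a) / (l%:R + 1).
  by rewrite -E mulrC mulKf // gt_eqF // ltr_wpDl // ltW.
move=> I.
have -> : W k 0%N / k%:R - u / (l%:R + 1) =
  (W k 0%N / k%:R - (l%:R * u + a) / (l%:R + 1) / l%:R) + a / (l%:R * (l%:R + 1)).
  by field; rewrite !gt_eqF.
have : (l%:R + 1) / n%:R / (l%:R * (l%:R + 1)) <= a / (l%:R * (l%:R + 1)).
  by rewrite ler_pM2r // invr_gt0 mulr_gt0.
move=> A; apply: le_trans (lerD I A).
rewrite -subr_ge0.
have -> : (l%:R - k%:R) / (l%:R * n%:R) + (l%:R + 1) / n%:R / (l%:R * (l%:R + 1)) -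
  (l%:R + 1 - k%:R) / ((l%:R + 1) * n%:R) = (l%:R + 1 - k%:R) / (l%:R * (l%:R + 1) * n%:R) :> R.
  by field; rewrite !gt_eqF.
rewrite divr_ge0 ?mulr_ge0 ?(ltW l0) ?(ltW l1) ?(ltW nR) //.
have : k%:R <= l%:R :> R by rewrite ler_nat; case/andP: kl.
lra.
Qed.

(* The bracket bounds from below the probability of meeting no nice candidate
   before level K and of entering it with copies to come: each level costs at most
   1 / (n - K), and an exhausted maximum survives from k to K with probability
   k / K. *)
Lemma balanced_early_ge K k r : (1 <= k <= K)%N -> (K < n)%N -> (r < m)%N ->
  K%:R / n%:R * (1 - (r == 0%N)%:R * (k%:R / K%:R)
                 - (K%:R - k%:R) / (n%:R - K%:R)) <= W k r.
Proof.
move=> + Kn; have nR : 0 < n%:R :> R by rewrite ltr0n.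
have dR : 0 < n%:R - K%:R :> R by rewrite subr_gt0 ltr_nat.
have [j] := ubnP (K - k)%N; elim: j k r => // j IH k r jn kK rm.
have KR : 0 < K%:R :> R by rewrite ltr0n; lia.
have [eK|{}kK] : k = K \/ (1 <= k < K)%N by lia.
  have /= := @balanced_ge k r ltac:(lia) rm.
  rewrite {}eK subrr mul0r subr0 divff ?lt0r_neq0 //.
  by case: (r) => [|r'] /=; rewrite !(mul0r, mul1r, subr0, subrr, mulr1, mulr0).
have [kn [kS [jS [m1 [m10 [kn' kn2]]]]]] : (1 <= k <= n)%N /\ (1 <= k.+1 <= K)%N /\
    (K - k.+1 < j)%N /\ (m.-1 < m)%N /\ (m.-1 == 0)%N = false /\ (k < n)%N /\
    (1 <= k < n)%N.
  by clear -kK jn Kn m2; lia.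
set s := (K%:R - k%:R) / _.
set p := K%:R / n%:R.
have pp : 0 < p by rewrite divr_gt0.
pose s' := (K%:R - k.+1%:R) / (n%:R - K%:R) : R.
have s'0 : 0 <= s' by rewrite divr_ge0 ?(ltW dR) // subr_ge0 ler_nat; lia.
have ss' : s = s' + (n%:R - K%:R)^-1 by rewrite /s /s' -natr1; field; rewrite gt_eqF.
have d0 : 0 < (n%:R - K%:R)^-1 :> R by rewrite invr_gt0.
have k1R : 0 < k.+1%:R :> R by rewrite ltr0n.
have Am := IH k.+1 m.-1 jS kS m1.
rewrite -/s' -/p m10 mul0r subr0 in Am.
case: r rm => [|r] rm.
  rewrite mul1r -(ler_pM2l k1R) balanced0 //.
  have := IH k.+1 0%N jS kS rm.
  rewrite -/s' -/p /= mul1r => A0.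
  have : k%:R * (p * (1 - k.+1%:R / K%:R - s')) <= k%:R * W k.+1 0%N by rewrite ler_wpM2l.
  suff : k.+1%:R * (p * (1 - k%:R / K%:R - s)) <=
     k%:R * (p * (1 - k.+1%:R / K%:R - s')) + p * (1 - s') by move: Am; lra.
  rewrite ss' -subr_ge0.
  have -> : k%:R * (p * (1 - k.+1%:R / K%:R - s')) + p * (1 - s') -
    k.+1%:R * (p * (1 - k%:R / K%:R - (s' + (n%:R - K%:R)^-1))) = k.+1%:R * p * (n%:R - K%:R)^-1.
    by rewrite -natr1; field; rewrite !gt_eqF.
  by apply: mulr_ge0; [apply: mulr_ge0|]; apply: ltW.
rewrite mul0r subr0.
have Ar := IH k.+1 r.+1 jS kS rm.
rewrite -/s' -/p mul0r subr0 in Ar.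
have N0 : 0 < m%:R * (n%:R - k%:R) :> R.
  by rewrite mulr_gt0 ?ltr0n ?subr_gt0 ?ltr_nat // (ltn_trans _ m2).
have dpos : 0 < r.+1%:R + m%:R * (n%:R - k%:R) :> R by rewrite ltr_wpDl.
have cm : p * (1 - s') <= new_candidate_mean m W k r.+1.
  rewrite /new_candidate_mean ler_pdivlMr //.
  have : k%:R * (p * (1 - s')) <= k%:R * W k.+1 r.+1 by rewrite ler_wpM2l.
  rewrite -natr1; move: Am; lra.
have W0 := @balanced_ge0 k r.+1 kn rm.
(* The bracket may be negative, and then nonnegativity of [W] suffices. *)
have [h|/ltW h] := leP (1 - s') 0.
  apply: le_trans W0; rewrite mulr_ge0_le0 ?(ltW pp) //; lra.
rewrite -(ler_pM2l dpos) -bW.2 //= eqSS.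
have X0 : 0 <= (if r == 0%N then X k else W k r).
  case: ifP => _; last by apply: balanced_ge0; rewrite // ltnW.
  by apply: le_trans (X_ge kn); rewrite divr_ge0.
(* The branch where a further copy of the maximal candidate comes first is estimated by 0. Its cost
   is controlled by [Nd] below, from r + 1 <= m and N >= m (n - K). *)
apply: (@le_trans _ _ (0 + m%:R * (n%:R - k%:R) * (p * (1 - s')))); last first.
  by rewrite lerD ?mulr_ge0 // ler_pM2l.
rewrite add0r ss' mulrCA [leRHS]mulrCA (ler_pM2l pp).
have dk : n%:R - K%:R <= n%:R - k%:R :> R.
  by rewrite lerD2l lerN2 ler_nat; case/andP: kK => _ /ltnW.
have rmR : r.+1%:R <= m%:R :> R by rewrite ler_nat ltnW.
set N := m%:R * (n%:R - k%:R) in N0 dpos *.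
have Nd : r.+1%:R <= N * (n%:R - K%:R)^-1.
  rewrite /N -mulrA; apply: le_trans rmR _; rewrite ler_peMr ?ler0n //.
  by rewrite ler_pdivlMr // mul1r.
rewrite -subr_ge0.
set a := r.+1%:R in Nd *; set e := (n%:R - K%:R)^-1 in d0 Nd *.
have a0 : 0 <= a by exact: ler0n.
have -> : N * (1 - s') - (a + N) * (1 - (s' + e)) = (N * e - a) + a * s' + a * e.
  by ring.
apply: addr_ge0; last by apply: mulr_ge0 => //; exact: ltW.
by apply: addr_ge0; [rewrite subr_ge0|apply: mulr_ge0].
Qed.

End Bounds.
End Balance.

(** Since 'C(r, q) 'C(q, s) = 'C(r, s) 'C(r - s, q - s), this is the binomial theorem; the proof
    goes by Pascal's rule. At x = 1 it is binomial inversion, at other x it produces binomial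
    probabilities. *)
Lemma binomial_sum_alternating (A : comPzRingType) (x : A) r s M : (r < M)%N ->
  \sum_(q < M) 'C(r, q)%:R * ((-1) ^+ (q + s) * 'C(q, s)%:R * x ^+ q)
  = 'C(r, s)%:R * x ^+ s * (1 - x) ^+ (r - s).
Proof.
elim: r s M => [|r IH] s [//|M] rM.
  rewrite big_ord_recl big1 => [|i _]; last by rewrite bin0n mul0r.
  by case: s => [|s]; rewrite !bin0n /= ?addn0 !(mul0r, mulr0, mul1r, mulr1, expr0, addr0).
pose f t q : A := (-1) ^+ (q + t) * 'C(q, t)%:R * x ^+ q.
have pascal t : \sum_(q < M.+1) 'C(r.+1, q)%:R * f t q =
    \sum_(q < M.+1) 'C(r, q)%:R * f t q + \sum_(q < M) 'C(r, q)%:R * f t q.+1.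
  rewrite !big_ord_recl !bin0 -addrA -big_split /=; congr (_ + _).
  by apply: eq_bigr => i _; rewrite binS natrD mulrDl.
rewrite pascal IH; last lia.
case: s => [|s].
  under eq_bigr => i _.
    have -> : 'C(r, i)%:R * f 0 i.+1 = - x * ('C(r, i)%:R * f 0 i).
      rewrite /f !addn0 !bin0 !exprS; ring.
    over.
  by rewrite -mulr_sumr IH // !bin0 !subn0 exprS; ring.
under eq_bigr => i _.
  have -> : 'C(r, i)%:R * f s.+1 i.+1 =
    - x * ('C(r, i)%:R * f s.+1 i) + x * ('C(r, i)%:R * f s i).
    rewrite /f binS natrD !addSn !addnS !exprS; ring.
  over.
rewrite big_split /= -!mulr_sumr !IH // binS natrD subSS.
have [sr|rs] := ltnP s r; last by rewrite (bin_small (n := r)) ?ltnS // exprS; ring.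
by rewrite -(subnSK sr) !exprS; ring.
Qed.

(** * Law of the number of remaining copies on reaching level K *)

Section Occupation.
Context {R : realFieldType} (m n K : nat).
Hypotheses (m2 : (2 <= m)%N) (K1 : (1 <= K <= n)%N).

(** [k%:R * survival q k] is the probability that the maximal candidate of level [k] is still
    maximal at level [K] (this gives k / K) and that [q] fixed copies of it, not yet inspected, are
    still to come then (this gives the product). *)
Definition survival q k : R :=
  K%:R^-1 * \prod_(k <= j < K)
    (m%:R * (n%:R - j%:R) / (m%:R * (n%:R - j%:R) + q%:R)).

(* The harmonic function equal to 'C(r, q) at level K: given r, the expectation of
   'C(_, q) at the arrival of the next new candidate is 'C(r, q) * N / (N + q)
   with N = m * (n - k), because q fixed copies must come after the first of N
   new objects. *)
Definition moment q k r : R :=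
  survival q k * (k%:R * 'C(r, q)%:R +
     'C(m, q)%:R / m%:R * (m%:R * (n%:R - k%:R) + q%:R))
  - 'C(m, q)%:R / m%:R * (m%:R * (n%:R - K%:R) + q%:R) / K%:R.

(* The probability of having s copies still to come on reaching level K. *)
Definition occupation s : R :=
  \sum_(q < m) (-1) ^+ (q + s) * 'C(q, s)%:R * moment q 1 m.-1.

Lemma moment_end q r : moment q K r = 'C(r, q)%:R.
Proof.
have KR : K%:R != 0 :> R by rewrite pnatr_eq0; lia.
have mR : m%:R != 0 :> R by rewrite pnatr_eq0; lia.
rewrite /moment /survival big_geq // mulr1; field; exact/andP.
Qed.

Lemma bin_pred q : (q < m)%N ->
  'C(m.-1, q)%:R = 'C(m, q)%:R / m%:R * (m%:R - q%:R) :> R.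
Proof.
move=> qm; have mR : m%:R != 0 :> R by rewrite pnatr_eq0; lia.
apply: (mulfI mR); rewrite -natrM mul_bin_down natrM natrB ?(ltnW qm) //.
by field.
Qed.

Lemma moment_start q : (q < m)%N -> moment q 1 m.-1 =
  'C(m, q)%:R * (n%:R * survival q 1 - (n%:R - K%:R + q%:R / m%:R) / K%:R).
Proof.
move=> qm.
have KR : K%:R != 0 :> R by rewrite pnatr_eq0; lia.
have mR : m%:R != 0 :> R by rewrite pnatr_eq0; lia.
by rewrite /moment bin_pred //; field; apply/andP.
Qed.

(** With reward [W k 0], accepting and waiting are worth the same, so the case [r = 1] is no longer
    special and the equation becomes linear in [W]. *)
Lemma harmonicE W k : balanced_at m n (W k 0%N : R) k W <->
  forall r, (r < m)%N ->
    r%:R * W k r.-1 + m%:R * (n%:R - k%:R) * new_candidate_mean m W k r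
    = (r%:R + m%:R * (n%:R - k%:R)) * W k r.
Proof.
by split=> bW r /bW <-; case: eqP => [->|].
Qed.

(** A copy of the maximal candidate acts through r 'C(r - 1, q) = (r - q) 'C(r, q). The term with m
    (n - k) + q makes up for a new maximum, which restarts with 'C(m - 1, q); the constant is
    harmonic by itself. *)
Lemma moment_harmonic q k : (q < m)%N -> (1 <= k < K)%N ->
  balanced_at m n (moment q k 0) k (moment q).
Proof.
move=> qm kK; apply/harmonicE => r rm.
have k1 : k.+1%:R != 0 :> R by rewrite pnatr_eq0.
have mR : m%:R != 0 :> R by rewrite pnatr_eq0; lia.
have N0 : 0 < m%:R * (n%:R - k%:R) :> R.
  by rewrite mulr_gt0 ?ltr0n ?subr_gt0 ?ltr_nat; lia.
set N := m%:R * (n%:R - k%:R) in N0 *.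
have Nq : N + q%:R != 0 :> R by rewrite gt_eqF // ltr_pwDl.
pose D : R := 'C(m, q)%:R / m%:R * (m%:R * (n%:R - K%:R) + q%:R) / K%:R.
have E : survival q k * (N + q%:R) = N * survival q k.+1.
  rewrite /survival big_ltn; last lia.
  rewrite -/N; move: K%:R^-1 (\prod_(k.+1 <= j < K) _) => c P.
  by field.
have -> : new_candidate_mean m (moment q) k r =
   survival q k.+1 * (k%:R * 'C(r, q)%:R + 'C(m, q)%:R / m%:R * N) - D.
  rewrite /new_candidate_mean /moment -/D bin_pred // /N.
  move: k1; rewrite -natr1 => k1.
  by field; rewrite mR.
have -> (u : R) : N * (survival q k.+1 * u - D) = survival q k * (N + q%:R) * u - N * D.
  by rewrite E; ring.
have B : r%:R * 'C(r.-1, q)%:R = (r%:R - q%:R) * 'C(r, q)%:R :> R.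
  have [qr|rq] := leqP q r; last by rewrite !bin_small ?mulr0 //; lia.
  by rewrite -natrB // -!natrM mul_bin_down.
rewrite /moment -/D -/N.
have -> (u : R) : r%:R * (survival q k * (k%:R * 'C(r.-1, q)%:R + u) - D) =
  survival q k * (k%:R * (r%:R * 'C(r.-1, q)%:R) + r%:R * u) - r%:R * D by ring.
rewrite B; ring.
Qed.

(** [H] combines the functions [moment q] so as to agree with [W] at level [K]. Harmonic functions
    that agree there agree below, and in [H 1 m.-1] the coefficient of [W K s] is [occupation s]. *)
Lemma harmonic_expansion W :
    (forall k, (1 <= k < K)%N -> balanced_at m n (W k 0%N : R) k W) ->
  W 1%N m.-1 = \sum_(s < m) occupation s * W K s.
Proof.
move=> bW.
pose H k r := \sum_(s < m) W K s *
   \sum_(q < m) (-1) ^+ (q + s) * 'C(q, s)%:R * moment q k r.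
have HK r : (r < m)%N -> H K r = W K r.
  move=> rm.
  (* Binomial inversion: at x = 1 the alternating sum is 'C(r, s) 0 ^ (r - s), which is 1 for r = s
     and 0 otherwise. *)
  have delta s : \sum_(q < m) (-1) ^+ (q + s) * 'C(q, s)%:R * moment q K r
      = (r == s)%:R.
    transitivity (\sum_(q < m) 'C(r, q)%:R * ((-1) ^+ (q + s) * 'C(q, s)%:R * 1 ^+ q) : R).
      by apply: eq_bigr => q _; rewrite moment_end expr1n mulr1 mulrC.
    rewrite binomial_sum_alternating // subrr expr1n mulr1 expr0n subn_eq0.
    have [h|h|->] := ltngtP s r; first by rewrite mulr0.
      by rewrite bin_small ?mul0r.
    by rewrite binn mulr1.
  rewrite /H (bigD1 (Ordinal rm)) //= delta eqxx mulr1 big1 ?addr0 // => s sr.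
  by rewrite delta eq_sym (negbTE (_ : s != r :> nat)) ?mulr0.
have bH k : (1 <= k < K)%N -> balanced_at m n (H k 0%N) k H.
  move=> kK; apply/harmonicE => r rm.
  rewrite /new_candidate_mean /H; set N := m%:R * _.
  rewrite !mulr_sumr -big_split /= !(mulr_suml, mulr_sumr) -big_split /=.
  apply: eq_bigr => s _.
  rewrite !mulr_sumr -!big_split /= !(mulr_suml, mulr_sumr) -big_split /=.
  apply: eq_bigr => q _.
  have /harmonicE/(_ r rm) := @moment_harmonic q k (ltn_ord q) kK.
  rewrite /new_candidate_mean -/N => e.
  transitivity (W K s * ((-1) ^+ (q + s) * 'C(q, s)%:R) * ((r%:R + N) * moment q k r)); last by ring.
  by rewrite -e; ring.
have main k : (1 <= k <= K)%N -> forall r, (r < m)%N -> W k r = H k r.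
  have [j] := ubnP (K - k)%N; elim: j k => // j IH k jk kK.
  have [->|kK'] : k = K \/ (1 <= k < K)%N by lia.
    by move=> r rm; rewrite HK.
  have IH' := IH k.+1 ltac:(lia) ltac:(lia).
  have e0 : W k 0%N = H k 0%N.
    have [kn m0 m1] : [/\ (k < n)%N, (0 < m)%N & (m.-1 < m)%N] by split; lia.
    by rewrite (balanced_at0 kn m0 (bW _ kK')) (balanced_at0 kn m0 (bH _ kK')) /new_candidate_mean !IH'.
  have bH' := bH _ kK'; rewrite -e0 in bH'.
  by apply: (balanced_at_eq _ _ (bW _ kK') bH'); rewrite ?e0 //; lia.
rewrite main /H; try lia.
by apply: eq_bigr => s _; rewrite mulrC.
Qed.

End Occupation.

(** * The optimal threshold *)

Section Threshold.
Context {R : realFieldType} (m n : nat).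
Hypotheses (m2 : (2 <= m)%N) (n1 : (1 <= n)%N).

(** The reward k / n is the probability that the best of [k] inspected candidates is the best of
    all. *)
Definition first_nice_value : nat -> nat -> R :=
  value m n (fun k _ => k%:R / n%:R).

(** A nice candidate leaves the choice between accepting, worth k / n, and waiting with no copy to
    come, worth [c]. *)
Definition optimal_value : nat -> nat -> R :=
  value m n (fun k c => Num.max (k%:R / n%:R) c).

Local Notation F := first_nice_value.
Local Notation V := optimal_value.

Lemma first_nice_balanced : balanced m n (fun k => k%:R / n%:R) F.
Proof. by apply: balanced_value; lia. Qed.

Lemma optimal_balanced :
  balanced m n (fun k => Num.max (k%:R / n%:R) (V k 0%N)) V.
Proof. by apply: (@balanced_value R m n (fun k c => Num.max (k%:R / n%:R) c)); lia. Qed.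

(** [K] is the first level with [F k 0 <= k / n]. As [F k 0 / k] decreases, the inequality persists
    above [K], so [V] equals [F] there. Below [K] waiting is at least as good, so [V] is harmonic
    and expands in its values at level [K]. *)
Lemma threshold_exists : exists K,
  [/\ (1 <= K <= n)%N,
      forall k, (K <= k <= n)%N -> F k 0%N <= k%:R / n%:R,
      forall k, (1 <= k < K)%N -> k%:R / n%:R < F k 0%N &
      V 1%N m.-1 = \sum_(s < m) occupation m n K s * F K s].
Proof.
have nR : 0 < n%:R :> R by rewrite ltr0n.
have Xge k : (1 <= k <= n)%N -> k%:R / n%:R <= k%:R / n%:R :> R by [].
have Yge k : (1 <= k <= n)%N -> k%:R / n%:R <= Num.max (k%:R / n%:R) (V k 0%N).
  by move=> _; rewrite le_max lexx.
have ratioF := exhausted_ratio_drop m2 n1 first_nice_balanced Xge.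
have ratioV := exhausted_ratio_drop m2 n1 optimal_balanced Yge.
have exK : exists k, (1 <= k)%N && (F k 0%N <= k%:R / n%:R).
  by exists n; rewrite n1 first_nice_balanced.1 divr_ge0.
case: (ex_minnP exK) => K /andP[K1 FK] minK.
have Kn : (K <= n)%N by apply: minK; rewrite n1 first_nice_balanced.1 divr_ge0.
have below k : (1 <= k < K)%N -> k%:R / n%:R < F k 0%N.
  move=> kK; rewrite ltNge; apply/negP => h.
  by have := minK k; rewrite h; lia.
have dropW (W : nat -> nat -> R) (h : forall k l, (0 < k)%N -> (k <= l <= n)%N ->
     (l%:R - k%:R) / (l%:R * n%:R) <= W k 0%N / k%:R - W l 0%N / l%:R) k l :
     (1 <= k <= l)%N -> (l <= n)%N -> W l 0%N / l%:R <= W k 0%N / k%:R.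
  move=> kl ln; rewrite -subr_ge0; apply: le_trans (h k l _ _); try lia.
  by rewrite divr_ge0 ?mulr_ge0 // subr_ge0 ler_nat; lia.
have above k : (K <= k <= n)%N -> F k 0%N <= k%:R / n%:R.
  move=> kK; have kR : 0 < k%:R :> R by rewrite ltr0n; lia.
  have KR : 0 < K%:R :> R by rewrite ltr0n; lia.
  have := dropW _ ratioF K k ltac:(lia) ltac:(lia).
  rewrite ler_pdivrMr // => /le_trans; apply.
  by rewrite mulrC ler_pM2l // ler_pdivrMr // mulrC.
have VF k : (K <= k <= n)%N -> forall r, (r < m)%N -> V k r = F k r.
  have [j] := ubnP (n - k)%N; elim: j k => // j IH k jk kK.
  have kn : (1 <= k <= n)%N by lia.
  have bF := first_nice_balanced.2 _ kn.
  have bV := optimal_balanced.2 _ kn.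
  have e0 : V k 0%N = F k 0%N.
    have [kn'|nk] := ltnP k n; last first.
      have -> : k = n by lia.
      by rewrite first_nice_balanced.1 optimal_balanced.1.
    by rewrite (balanced_at0 kn' _ bV) ?(balanced_at0 kn' _ bF) /new_candidate_mean ?IH //; lia.
  rewrite e0 max_l in bV; last exact: above.
  apply: (balanced_at_eq _ _ bV bF) => //; try lia.
  by move=> kn'; apply: IH; lia.
exists K; split => //; first by rewrite K1.
rewrite (@harmonic_expansion _ m n K m2 _ V); last first.
- move=> k kK; have kn : (1 <= k <= n)%N by lia.
  have := optimal_balanced.2 _ kn; rewrite max_r //.
  have kR : 0 < k%:R :> R by rewrite ltr0n; lia.
  have lR : 0 < K.-1%:R :> R by rewrite ltr0n; lia.
  have := dropW _ ratioV k K.-1 ltac:(lia) ltac:(lia).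
  rewrite ler_pdivlMr // => h; apply: le_trans h; rewrite mulrC ler_pM2r //.
  have l1 : (1 <= K.-1 <= n)%N by lia.
  (* [V] and [F] agree only from [K] on, but with no copy to come the value at K - 1 is a mean over
     level [K]. *)
  have -> : V K.-1 0%N = F K.-1 0%N.
    have [l2 m0 m1] : [/\ (K.-1 < n)%N, (0 < m)%N & (m.-1 < m)%N] by split; lia.
    rewrite (balanced_at0 l2 m0 (optimal_balanced.2 _ l1)).
    rewrite (balanced_at0 l2 m0 (first_nice_balanced.2 _ l1)).
    by rewrite /new_candidate_mean prednK // !VF // leqnn.
  rewrite ler_pdivlMr // mulrC; apply/ltW/below; lia.
- by rewrite K1.
by apply: eq_bigr => s _; rewrite VF // leqnn.
Qed.

End Threshold.

(** * Orders and visible information *)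

Section Sequences.
Implicit Types (s : seq nat) (x : nat).

Lemma maximal_rcons s x : maximal (rcons s x) = maxn (maximal s) x.
Proof. by rewrite /maximal -cats1 big_cat big_seq1. Qed.

Lemma leq_maximal s x : x \in s -> (x <= maximal s)%N.
Proof. by move=> xs; rewrite /maximal (big_rem x) //= leq_maxl. Qed.

Lemma maximal_mem s x : x \in s -> maximal s \in s.
Proof.
elim/last_ind: s x => // s y IH x _; rewrite maximal_rcons mem_rcons inE.
case: s IH => [|z s] IH; first by rewrite /maximal big_nil max0n eqxx.
have := IH z (mem_head _ _); case: leqP => _ h; rewrite ?eqxx // h orbT //.
Qed.

Lemma maximal_ltn s n : (0 < n)%N -> all (gtn n) s -> (maximal s < n)%N.
Proof.
move=> n0 /allP sn; case: s sn => [|x s] sn; first by rewrite /maximal big_nil.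
exact/sn/(maximal_mem (mem_head x s)).
Qed.

(** Expresses maximality by comparisons alone, the form in which it is visible during the
    inspection. *)
Lemma maximal_eq s x : x \in s -> (x == maximal s) = all (leq^~ x) s.
Proof.
move=> xs; apply/eqP/allP => [-> y|h]; first exact: leq_maximal.
by apply/eqP; rewrite eqn_leq leq_maximal //= h // (maximal_mem xs).
Qed.

Lemma ndifferent_rcons s x : ndifferent (rcons s x) = (ndifferent s + (x \notin s))%N.
Proof.
have /perm_size : perm_eq (undup (rcons s x)) (undup (x :: s)).
  by apply: perm_undup => y; rewrite mem_rcons.
by rewrite /ndifferent /= => ->; case: (x \in s); rewrite /= ?addn0 ?addn1.
Qed.

Lemma ncopies_max_rcons s x : ncopies_max (rcons s x) =
  if x == maximal s then (ncopies_max s).+1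
  else if (maximal s < x)%N then 1%N else ncopies_max s.
Proof.
rewrite /ncopies_max maximal_rcons -cats1 count_cat /= addn0.
case: (ltngtP x (maximal s)) => h; last by rewrite h eqxx addn1.
  by rewrite (ltn_eqF h) addn0.
rewrite eqxx (count_memPn _) //.
by apply: contraL h => /leq_maximal; rewrite -leqNgt.
Qed.

Lemma sum_mem_ndifferent s n : all (gtn n) s ->
  (\sum_(c < n) (val c \in s) = ndifferent s)%N.
Proof.
move=> /allP sn; rewrite /ndifferent.
rewrite -(big_mkord xpredT (fun c => nat_of_bool (c \in s))) -big_mkcond /= sum1_count.
rewrite -size_filter; apply/perm_size/uniq_perm; rewrite ?undup_uniq ?filter_uniq ?iota_uniq //.
move=> x; rewrite mem_filter mem_undup mem_index_iota leq0n /=.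
by case xs: (x \in s) => //=; apply/sn.
Qed.

End Sequences.

Section Orders.
Context {m n : nat}.
Hypothesis m0 : (0 < m)%N.
Implicit Types (w : 'S_(m * n)) (t : nat) (u : 'I_(m * n)).


Definition times t : seq 'I_(m * n) := take t (enum 'I_(m * n)).

Lemma mem_times t u : (u \in times t) = (u < t)%N.
Proof.
rewrite /times in_take ?mem_enum // index_enum_ord //.
Qed.

Lemma inspectedE w t : inspected w t = [seq cand w a | a <- times t].
Proof. by rewrite /inspected map_take. Qed.

Lemma inspectedS w u : inspected w u.+1 = rcons (inspected w u) (cand w u).
Proof.
rewrite /inspected (take_nth (cand w u)) ?size_map ?size_enum_ord //.
rewrite (nth_map u) ?nth_ord_enum // ?size_enum_ord //.
by rewrite -enumT size_enum_ord.
Qed.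

Lemma mem_inspected w t u : (u < t)%N -> cand w u \in inspected w t.
Proof. by move=> ut; rewrite inspectedE map_f // mem_times. Qed.

Lemma cand_ltn w u : (cand w u < n)%N.
Proof. by rewrite /cand ltn_divLR // [X in (_ < X)%N]mulnC. Qed.

Lemma inspected_ltn w t : all (gtn n) (inspected w t).
Proof. by rewrite inspectedE all_map; apply/allP => u _ /=; exact: cand_ltn. Qed.

Lemma card_copies c : (c < n)%N -> #|[pred x : 'I_(m * n) | x %/ m == c]%N| = m.
Proof.
move=> cn; rewrite -sum1_card big_mkcond /=.
rewrite -(big_mkord xpredT (fun x => if x %/ m == c then 1 else 0)%N) mulnC big_nat_mul.
rewrite (eq_big_nat _ _ (F2 := fun k => if k == c then m else 0)%N).
  by rewrite -big_mkcond big_nat1_eq cn.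
move=> k _; rewrite (eq_big_nat _ _ (F2 := fun=> if k == c then 1 else 0)%N).
  rewrite sum_nat_const_nat mulSn addnK; case: eqP => _; rewrite ?muln1 ?muln0 //.
move=> j /andP[kj jk].
suff -> : (j %/ m)%N = k by [].
by apply/eqP; rewrite eqn_leq leq_divRL // kj andbT -ltnS ltn_divLR.
Qed.

Lemma card_cand w c : (c < n)%N -> #|[pred u : 'I_(m * n) | cand w u == c]| = m.
Proof.
move=> cn; rewrite -[RHS](card_copies cn) -!sum1_card [RHS](reindex_inj (@perm_inj _ w)).
by apply: eq_bigl => u.
Qed.

Lemma count_inspected w t c :
  count_mem c (inspected w t) = #|[pred u : 'I_(m * n) | (u < t)%N && (cand w u == c)]|.
Proof.
rewrite inspectedE count_map -size_filter.
rewrite -(card_uniqP _); last by rewrite filter_uniq // take_uniq // enum_uniq.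
by apply: eq_card => u; rewrite !inE mem_filter mem_times andbC.
Qed.

Lemma card_remaining w t c : (c < n)%N ->
  #|[pred u : 'I_(m * n) | (t <= u)%N && (cand w u == c)]| =
  (m - count_mem c (inspected w t))%N.
Proof.
move=> cn; rewrite count_inspected.
rewrite -[X in _ = (X - _)%N](card_cand w cn).
rewrite -(cardID [pred u : 'I_(m * n) | u < t]%N [pred u | cand w u == c]).
set B := #|[predD _ & _]|.
have -> : #|[predI [pred u | cand w u == c] & [pred u : 'I_(m * n) | u < t]%N]| =
    #|[pred u : 'I_(m * n) | (u < t)%N && (cand w u == c)]|.
  by apply: eq_card => u; rewrite !inE andbC.
by rewrite addKn /B; apply: eq_card => u; rewrite !inE -leqNgt.
Qed.

Lemma count_inspected_leq w t c : (count_mem c (inspected w t) <= m)%N.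
Proof.
have [cn|nc] := ltnP c n; last first.
  rewrite (count_memPn _) //; apply/negP => /(allP (inspected_ltn w t)) /=.
  by rewrite ltnNge nc.
rewrite -[X in (_ <= X)%N](card_cand w cn) count_inspected; apply: subset_leq_card.
apply/fintype.subsetP => u; rewrite !inE => /andP[_ h]; exact: h.
Qed.

(* same_info u w w' is same_prefix u.+1 w w'. *)
Definition same_prefix t w w' : Prop := forall a b : 'I_(m * n),
  (a < t)%N -> (b < t)%N -> (cand w a <= cand w b)%N = (cand w' a <= cand w' b)%N.

(** Measurability with respect to the information available after [t] inspections. *)
Definition adapted {T : Type} t (f : 'S_(m * n) -> T) : Prop :=
  forall w w', same_prefix t w w' -> f w = f w'.

Lemma adaptedW {T : Type} t t' (f : 'S_(m * n) -> T) : (t <= t')%N ->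
  adapted t f -> adapted t' f.
Proof.
move=> tt' af w w' s; apply: af => a b at_ bt.
by apply: s; apply: leq_trans tt'.
Qed.

Lemma adapted_old u : adapted u.+1 (fun w => cand w u \in inspected w u).
Proof.
move=> w w' s; rewrite !inspectedE.
have E v : (cand v u \in [seq cand v a | a <- times u]) =
    has (fun a => cand v a == cand v u) (times u).
  by elim: (times u) => //= a l <-; rewrite inE eq_sym.
rewrite !E; apply: eq_in_has => a; rewrite mem_times => au.
by rewrite !eqn_leq !s // ltnW.
Qed.

Lemma adapted_ndifferent t : adapted t (fun w => ndifferent (inspected w t)).
Proof.
elim: t => [|t IH] w w' s; first by rewrite /inspected !take0.
have IH' := IH w w' (fun a b at_ bt => s a b (ltnW at_) (ltnW bt)).
have [h|h] := ltnP t (m * n); last first.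
  have e (v : 'S_(m * n)) : inspected v t.+1 = inspected v t.
    have sz : size [seq cand v j | j <- enum 'I_(m * n)] = (m * n)%N by rewrite size_map size_enum_ord.
    by rewrite /inspected !take_oversize ?sz ?(leqW h) ?h. 
  by rewrite !e.
by rewrite !(inspectedS _ (Ordinal h)) !ndifferent_rcons IH' (@adapted_old (Ordinal h) _ _ s).
Qed.

(** The label of the maximal candidate is hidden, so its copies are counted as the inspected
    positions that no other inspected position beats. *)
Lemma adapted_ncopies_max t : adapted t (fun w => ncopies_max (inspected w t)).
Proof.
move=> w w' s.
have E v : ncopies_max (inspected v t) =
    count (fun a => all (fun b => cand v b <= cand v a)%N (times t)) (times t).
  rewrite /ncopies_max inspectedE count_map; apply: eq_in_count => a ta /=.
  by rewrite maximal_eq ?map_f // all_map.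
rewrite !E; apply: eq_in_count => a; rewrite mem_times => ta.
by apply: eq_in_all => b; rewrite mem_times => tb; exact: s.
Qed.

Lemma adapted_record u : adapted u.+1 (fun w => cand w u == maximal (inspected w u.+1)).
Proof.
move=> w w' s; rewrite !maximal_eq ?mem_inspected // !inspectedE !all_map.
by apply: eq_in_all => b; rewrite mem_times => tb; exact: s.
Qed.

Lemma adapted_nice u : adapted u.+1 (fun w => nice w u).
Proof.
by move=> w w' s; rewrite /nice (adapted_record s) (adapted_ncopies_max s).
Qed.

End Orders.

(** * Exchange of two consecutive candidates *)

Definition exchange_cand (c x : nat) : nat :=
  if x == c then c.+1 else if x == c.+1 then c else x.

Lemma exchange_candK c : involutive (exchange_cand c).
Proof.
move=> y; rewrite /exchange_cand.
have [->|h] := eqVneq y c; first by rewrite (gtn_eqF (ltnSn c)) eqxx.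
have [->|h'] := eqVneq y c.+1; first by rewrite eqxx.
by rewrite (negbTE h) (negbTE h').
Qed.

(** In the absence of [c] only [c.+1] moves, into the vacant place just below it, so no comparison
    changes. *)
Lemma exchange_cand_leq c x y : x <> c -> y <> c ->
  (exchange_cand c x <= exchange_cand c y)%N = (x <= y)%N.
Proof.
move=> xc yc; rewrite /exchange_cand (introF eqP xc) (introF eqP yc).
case: eqP => ?; case: eqP => ?; lia.
Qed.

(** The copies of [c] and of [c.+1] fill adjacent blocks of [m] numbers, so a shift by [m] exchanges
    them. *)
Definition exchange_obj (m c x : nat) : nat :=
  if (x %/ m == c)%N then (x + m)%N
  else if (x %/ m == c.+1)%N then (x - m)%N else x.

Lemma exchange_objE m c x : (0 < m)%N ->
  (exchange_obj m c x %/ m)%N = exchange_cand c (x %/ m).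
Proof.
move=> m0; rewrite /exchange_obj /exchange_cand.
case: eqP => [e|_]; first by rewrite divnDr // divnn m0 e addn1.
case: eqP => // e; have mx : (m <= x)%N by rewrite -(mul1n m) -leq_divRL // e.
by rewrite -{1}(mul1n m) divnBMl e subn1.
Qed.

Lemma exchange_objK m c : (0 < m)%N -> involutive (exchange_obj m c).
Proof.
move=> m0 x; rewrite {1}/exchange_obj exchange_objE //.
rewrite /exchange_obj /exchange_cand; case: (eqVneq (x %/ m)%N c) => [e|ne].
  by rewrite eqxx addnK (_ : (c.+1 == c) = false) //; apply/eqP; lia.
case: (eqVneq (x %/ m)%N c.+1) => [e|ne2]; last by rewrite (negbTE ne) (negbTE ne2).
by rewrite eqxx subnK // -(mul1n m) -leq_divRL // e.
Qed.

Lemma exchange_obj_ltn m n c x : (0 < m)%N -> (c.+1 < n)%N -> (x < m * n)%N ->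
  (exchange_obj m c x < m * n)%N.
Proof.
move=> m0 cn; rewrite mulnC -!ltn_divLR // exchange_objE // /exchange_cand => xn.
by case: ifP => // _; case: ifP => // _; lia.
Qed.

(** * Sums over all orders given the visible information *)

Section Sums.
Context {R : realType} {m n : nat}.
Hypothesis m0 : (0 < m)%N.
Implicit Types (w : 'S_(m * n)) (t : nat) (u : 'I_(m * n)) (g : 'S_(m * n) -> R).

(** Turns the exchange into a substitution in sums over all orders, since multiplication by a fixed
    permutation is a bijection. *)
Lemma exchange_perm c : (c.+1 < n)%N -> exists p : 'S_(m * n),
  forall w u, cand (w * p)%g u = exchange_cand c (cand w u).
Proof.
move=> cn; pose f (x : 'I_(m * n)) := Ordinal (exchange_obj_ltn m0 cn (ltn_ord x)).
have f_inj : injective f.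
  by move=> x y [] /(can_inj (exchange_objK c m0)) /val_inj.
by exists (perm f_inj) => w u; rewrite /cand permM permE /= exchange_objE.
Qed.

(* Exchanging two consecutive candidates is invisible unless both are inspected. *)
Lemma sum_inspected_succ g t c : adapted t g -> (c.+1 < n)%N ->
  \sum_w g w * (c \in inspected w t)%:R = \sum_w g w * (c.+1 \in inspected w t)%:R.
Proof.
move=> ag cn; have [p pE] := exchange_perm cn.
have memE w x : (x \in inspected (w * p)%g t) = (exchange_cand c x \in inspected w t).
  rewrite !inspectedE.
  have -> : [seq cand (w * p)%g a | a <- times t] =
      [seq exchange_cand c y | y <- [seq cand w a | a <- times t]].
    by rewrite -map_comp; apply: eq_map => a /=.
  have ck := exchange_candK c.
  by rewrite -{1}(ck x) mem_map //; exact: inv_inj.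
(* Here exactly one of the two candidates has been inspected: the exchange maps the two events to
   each other and leaves [g] unchanged. *)
have key : \sum_w g w * ((c \in inspected w t) && (c.+1 \notin inspected w t))%:R =
    \sum_w g w * ((c.+1 \in inspected w t) && (c \notin inspected w t))%:R.
  rewrite (reindex_inj (mulIg p)) /=; apply: eq_bigr => w _; rewrite !memE.
  have -> : exchange_cand c c = c.+1 by rewrite /exchange_cand eqxx.
  have -> : exchange_cand c c.+1 = c.
    by have := exchange_candK c c; rewrite {2}/exchange_cand eqxx.
  have [/andP[_ cw]|_] := boolP (_ && _); last by rewrite mulr0n !mulr0.
  congr (_ * _); apply: ag => a b at_ bt; rewrite !pE.
  have ha (v : 'I_(m * n)) : (v < t)%N -> cand w v <> c.
    by move=> vt e; move: cw; rewrite -e mem_inspected.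
  by rewrite exchange_cand_leq //; exact: ha.
have split2 (a b : bool) : a%:R = (a && b)%:R + (a && ~~ b)%:R :> R.
  by case: a b => -[]; rewrite /= ?addr0 ?add0r.
under eq_bigr => w _ do rewrite (split2 _ (c.+1 \in inspected w t)) mulrDr.
rewrite big_split key -big_split /=; apply: eq_bigr => w _.
by rewrite -mulrDr andbC -split2.
Qed.

(** By repeated exchanges the sum is the same for every candidate in place of [n.-1], and these [n]
    equal sums add up to the sum weighted with the number of inspected candidates. *)
Lemma sum_best_inspected g t : (0 < n)%N -> adapted t g ->
  \sum_w g w * (n.-1 \in inspected w t)%:R =
  \sum_w g w * ((ndifferent (inspected w t))%:R / n%:R).
Proof.
move=> n0 ag; have nR : n%:R != 0 :> R by rewrite pnatr_eq0 -lt0n.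
have all_eq c : (c < n)%N -> \sum_w g w * (c \in inspected w t)%:R =
    \sum_w g w * (n.-1 \in inspected w t)%:R.
  have [j] := ubnP (n - c)%N; elim: j c => // j IH c jc cn.
  have [->//|cn'] : c = n.-1 \/ (c.+1 < n)%N by lia.
  by rewrite (sum_inspected_succ ag cn') IH //; lia.
apply: (mulIf nR); rewrite [RHS]mulr_suml.
transitivity (\sum_w \sum_(c < n) g w * (val c \in inspected w t)%:R).
  rewrite exchange_big /=.
  rewrite [RHS](eq_bigr (fun=> \sum_w g w * (n.-1 \in inspected w t)%:R)).
    by rewrite sumr_const card_ord mulr_natr.
  by move=> c _; exact: all_eq.
apply: eq_bigr => w _.
rewrite -mulr_sumr -natr_sum (sum_mem_ndifferent (inspected_ltn m0 w t)).
by rewrite -mulrA divfK.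
Qed.

(* The next object is uniform among the objects not yet inspected. *)
Lemma sum_next (G : 'S_(m * n) -> nat -> R) u :
    (forall w w', (forall a : 'I_(m * n), (a < u)%N -> w a = w' a) -> G w =1 G w') ->
  (m * n - u)%:R * \sum_w G w (cand w u) =
  \sum_w \sum_(c < n) (m - count_mem (val c) (inspected w u))%:R * G w c.
Proof.
move=> Gu.
have -> : \sum_w \sum_(c < n) (m - count_mem (val c) (inspected w u))%:R * G w c =
    \sum_w \sum_(v : 'I_(m * n) | (u <= v)%N) G w (cand w v).
  apply: eq_bigr => w _.
  rewrite (partition_big (fun v => Ordinal (cand_ltn m0 w v)) xpredT) //=.
  apply: eq_bigr => c _; rewrite -(card_remaining m0 w u (ltn_ord c)).
  rewrite (eq_bigr (fun=> G w c)); last by move=> v /andP[_ /eqP <-].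
  by rewrite sumr_const mulr_natl.
rewrite exchange_big /= [RHS](eq_bigr (fun=> \sum_w G w (cand w u))); last first.
  (* Transposing the times [u] and [v] keeps the first [u] inspections, hence [G], and brings the
     object of time [v] to time [u]. *)
  move=> v uv; rewrite (reindex_inj (mulgI (tperm u v))) /=; apply: eq_bigr => w _.
  rewrite /cand permM tpermR; apply: Gu => a au; rewrite permM tpermD //.
    by apply: contraTneq au => <-; rewrite ltnn.
  by apply: contraTneq au => <-; rewrite -leqNgt.
rewrite sumr_const mulr_natl; congr (_ *+ _).
rewrite -[X in (X - u)%N]card_ord -(cardID [pred v : 'I_(m * n) | v < u]%N predT).
set B := #|[predD _ & _]|.
have -> : #|[predI predT & [pred v : 'I_(m * n) | v < u]%N]| = u.
  have inj : injective (widen_ord (ltnW (ltn_ord u))) by move=> a b [] /val_inj.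
  rewrite -[RHS]card_ord -(fintype.card_image inj).
  apply: eq_card => v; rewrite !inE; apply/idP/fintype.imageP => [vu|[a _ ->]] /=.
    by exists (Ordinal vu) => //; apply: val_inj.
  exact: ltn_ord.
by rewrite addKn /B; apply: eq_card => v; rewrite !inE andbT -leqNgt.
Qed.

End Sums.

(** * Transitions of the chain of levels and remaining copies *)

Section Chain.
Context {R : realType} {m n : nat}.
Hypotheses (m2 : (2 <= m)%N) (n0 : (0 < n)%N).
Implicit Types (w : 'S_(m * n)) (t : nat) (u : 'I_(m * n)) (g : 'S_(m * n) -> R).

Let m0 : (0 < m)%N := ltnW m2.

Definition distinct w t := ndifferent (inspected w t).

Definition remaining w t := (m - ncopies_max (inspected w t))%N.

Definition above_all w u := (maximal (inspected w u) < cand w u)%N.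

Lemma inspected_maximal w t : (0 < t)%N ->
  maximal (inspected w t) \in inspected w t.
Proof.
move=> t0; have N0 : (0 < m * n)%N by rewrite muln_gt0 m0.
exact: (maximal_mem (mem_inspected w (u := Ordinal N0) t0)).
Qed.

Lemma ncopies_max_bounds w t : (0 < t)%N ->
  (1 <= ncopies_max (inspected w t) <= m)%N.
Proof.
move=> t0; rewrite /ncopies_max count_inspected_leq // andbT -has_count has_pred1.
exact: inspected_maximal.
Qed.

Lemma remaining_ltn w t : (0 < t)%N -> (remaining w t < m)%N.
Proof. by move=> /(ncopies_max_bounds w); rewrite /remaining; lia. Qed.

Lemma distinct_bounds w t : (0 < t)%N -> (1 <= distinct w t <= n)%N.
Proof.
move=> t0; rewrite /distinct; apply/andP; split.
  rewrite /ndifferent lt0n size_eq0; apply/negP => /eqP/undup_nil e.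
  by have := inspected_maximal w t0; rewrite e.
rewrite -(sum_mem_ndifferent (inspected_ltn m0 w t)) -[X in (_ <= X)%N]card_ord -sum1_card.
by apply: leq_sum => c _; exact: leq_b1.
Qed.

Lemma maximal_inspected_ltn w t : (maximal (inspected w t) < n)%N.
Proof. exact/(maximal_ltn n0)/inspected_ltn. Qed.

Lemma above_all_new w u : above_all w u -> cand w u \notin inspected w u.
Proof. by apply: contraL => /leq_maximal; rewrite -leqNgt. Qed.

Lemma distinctS w u :
  distinct w u.+1 = (distinct w u + (cand w u \notin inspected w u))%N.
Proof. by rewrite /distinct inspectedS ndifferent_rcons. Qed.

Lemma ncopies_maxS w u : ncopies_max (inspected w u.+1) =
  if cand w u == maximal (inspected w u) then (ncopies_max (inspected w u)).+1
  else if above_all w u then 1%N else ncopies_max (inspected w u).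
Proof. by rewrite inspectedS ncopies_max_rcons. Qed.

Lemma recordE w u : (cand w u == maximal (inspected w u.+1)) =
  (cand w u == maximal (inspected w u)) || above_all w u.
Proof.
rewrite inspectedS maximal_rcons /above_all.
by case: (ltngtP (cand w u) (maximal (inspected w u))) => // h; rewrite ?(ltn_eqF h) ?(gtn_eqF h) ?eqxx.
Qed.

Lemma adapted_distinct t : adapted t (fun w => distinct w t).
Proof. exact: adapted_ndifferent. Qed.

Lemma adapted_remaining t : adapted t (fun w => remaining w t).
Proof. by move=> w w' s; rewrite /remaining (adapted_ncopies_max s). Qed.

(** With nothing inspected, [maximal] takes the default 0 and the comparison would reveal the hidden
    label of the first candidate. Later a new maximum is a record by a candidate not seen before,
    and both properties are visible. *)
Lemma adapted_above_all u : (0 < u)%N -> adapted u.+1 (fun w => above_all w u).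
Proof.
move=> u0 w w' s.
have E v : above_all v u =
    (cand v u == maximal (inspected v u.+1)) && (cand v u \notin inspected v u).
  rewrite recordE; have [av|nv] := boolP (above_all v u).
    by rewrite orbT above_all_new.
  by rewrite orbF; case: eqP => //= ->; rewrite inspected_maximal.
by rewrite !E (adapted_record s) (adapted_old s).
Qed.

Lemma same_prefix_eq t w w' :
  (forall a : 'I_(m * n), (a < t)%N -> w a = w' a) -> same_prefix t w w'.
Proof. by move=> e a b at_ bt; rewrite /cand !e. Qed.

Lemma inspected_eq t w w' :
  (forall a : 'I_(m * n), (a < t)%N -> w a = w' a) -> inspected w t = inspected w' t.
Proof.
move=> e; rewrite !inspectedE; apply/eq_in_map => a; rewrite mem_times => at_.
by rewrite /cand e.
Qed.

Lemma sum_copy_of_maximal g u : adapted u g ->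
  (m * n - u)%:R * \sum_w g w * (cand w u == maximal (inspected w u))%:R =
  \sum_w g w * (remaining w u)%:R.
Proof.
move=> ag; pose G w c := g w * (c == maximal (inspected w u))%:R.
rewrite (sum_next m0 (G := G)); last first.
  by move=> w w' e c; rewrite /G (ag _ _ (same_prefix_eq e)) (inspected_eq e).
apply: eq_bigr => w _; rewrite (bigD1 (Ordinal (maximal_inspected_ltn w u))) //=.
rewrite big1 ?addr0 /G; first by rewrite eqxx mulr1 mulrC.
by move=> c; rewrite -val_eqE /= => /negbTE ->; rewrite !mulr0.
Qed.

Lemma sum_new g u : adapted u g ->
  (m * n - u)%:R * \sum_w g w * (cand w u \notin inspected w u)%:R =
  \sum_w g w * (m%:R * (n%:R - (distinct w u)%:R)).
Proof.
move=> ag; pose G w c := g w * (c \notin inspected w u)%:R.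
rewrite (sum_next m0 (G := G)); last first.
  by move=> w w' e c; rewrite /G (ag _ _ (same_prefix_eq e)) (inspected_eq e).
apply: eq_bigr => w _.
rewrite /distinct -(sum_mem_ndifferent (inspected_ltn m0 w u)) natr_sum.
rewrite -[X in X%:R - _]card_ord -sum1_card natr_sum -sumrB !mulr_sumr.
apply: eq_bigr => c _; rewrite /G.
case: (boolP (_ \in _)) => h; first by rewrite subrr !mulr0.
by rewrite (count_memPn h) subn0 subr0 !mulr1 mulrC.
Qed.

(* Computed backwards: a new maximum is the best candidate with probability
   (k + 1) / n, while the next object is a copy of the best candidate and new
   with probability (m / (m * n - u)) * (1 - k / n). *)
Lemma sum_above_all g u : (0 < u)%N -> adapted u g ->
  (m * n - u)%:R * \sum_w g w * (above_all w u)%:R =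
  \sum_w g w * (m%:R * (n%:R - (distinct w u)%:R) / (distinct w u).+1%:R).
Proof.
move=> u0 ag; have nR : n%:R != 0 :> R by rewrite pnatr_eq0 -lt0n.
(* Dividing by k + 1 beforehand cancels the probability (k + 1) / n that a new maximum is the best
   candidate. *)
pose h w := g w / (distinct w u).+1%:R.
have ah : adapted u h by move=> w w' s; rewrite /h (ag _ _ s) (adapted_distinct s).
have aD : adapted u.+1 (fun w => h w * (above_all w u)%:R).
  move=> w w' s; rewrite (adapted_above_all u0 s).
  by rewrite (adaptedW _ ah s).
pose G w c := h w * ((c == n.-1) && (c \notin inspected w u))%:R.
(* The next object is new and a copy of [n.-1] exactly if it is a new maximum after which the best
   candidate has been inspected. *)
have GE : \sum_w G w (cand w u) = \sum_w g w * (above_all w u)%:R / n%:R.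
  transitivity (\sum_w h w * (above_all w u)%:R * (n.-1 \in inspected w u.+1)%:R).
    apply: eq_bigr => w _; rewrite /G -mulrA -natrM mulnb; congr (_ * _%:R).
    have mx := maximal_inspected_ltn w u; have xn := cand_ltn m0 w u.
    rewrite inspectedS mem_rcons inE; apply: congr1.
    apply/andP/andP => [[/eqP e new]|[ab /orP[/eqP->|/leq_maximal h']]].
    - split; last by rewrite e eqxx.
      rewrite /above_all ltn_neqAle {2}e -ltnS prednK // mx andbT.
      by apply: contraNneq new => <-; exact: inspected_maximal.
    - by rewrite eqxx above_all_new.
    by move: ab; rewrite /above_all; lia.
  rewrite (sum_best_inspected m0 n0 aD); apply: eq_bigr => w _.
  rewrite -/(distinct w u.+1) distinctS /h.
  have [ab|_] := boolP (above_all w u); last by rewrite !mulr0 !mul0r.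
  by rewrite (above_all_new ab) addn1 !mulr1 mulrA divfK // pnatr_eq0.
have : (m * n - u)%:R * (\sum_w g w * (above_all w u)%:R / n%:R) =
    \sum_w h w * (m%:R * (1 - (distinct w u)%:R / n%:R)).
  rewrite -GE (sum_next m0 (G := G)); last first.
    by move=> w w' e c; rewrite /G (ah _ _ (same_prefix_eq e)) (inspected_eq e).
  have n1 : (n.-1 < n)%N by rewrite prednK.
  transitivity (\sum_w (h w * m%:R - h w * m%:R * (n.-1 \in inspected w u)%:R)).
    apply: eq_bigr => w _; rewrite (bigD1 (Ordinal n1)) //= big1 ?addr0 /G; last first.
      by move=> c; rewrite -val_eqE /= => /negbTE ->; rewrite !mulr0.
    rewrite eqxx /=; case: (boolP (_ \in _)) => h'; first by rewrite !mulr0 mulr1 subrr.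
    by rewrite (count_memPn h') subn0 mulr0 subr0 mulr1 mulrC.
  have am : adapted u (fun w => h w * m%:R) by move=> w w' s; rewrite (ah _ _ s).
  rewrite sumrB (sum_best_inspected m0 n0 am) -sumrB; apply: eq_bigr => w _.
  by rewrite -/(distinct w u); ring.
rewrite -mulr_suml mulrA => /(congr1 (fun x => x * n%:R)); rewrite divfK // => ->.
rewrite mulr_suml; apply: eq_bigr => w _; rewrite /h.
have k1 : (distinct w u).+1%:R != 0 :> R by rewrite pnatr_eq0.
by move: _.+1%:R k1 => q q0; field; rewrite nR q0.
Qed.

Definition value_after (X : nat -> R) (W : nat -> nat -> R) w u : R :=
  if nice w u then X (distinct w u.+1) else W (distinct w u.+1) (remaining w u.+1).

(** Martingale property: by [balanced], the conditional expectation of the value after an inspection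
    is the value before it, here tested against adapted weights. *)
Lemma one_step X W g u : (0 < u)%N -> balanced m n X W -> adapted u g ->
  \sum_w g w * value_after X W w u = \sum_w g w * W (distinct w u) (remaining w u).
Proof.
move=> u0 bW ag.
pose k w := distinct w u; pose r w := remaining w u.
pose a w := if r w == 1%N then X (k w) else W (k w) (r w).-1.
pose b w := W (k w).+1 m.-1; pose c w := W (k w).+1 (r w); pose d w := W (k w) (r w).
(* One increment for each kind of change; a new maximum is also a new candidate, hence its
   correction [b w - c w]. *)
have value_afterE w : value_after X W w u = d w +
   ((a w - d w) * (cand w u == maximal (inspected w u))%:R +
    (c w - d w) * (cand w u \notin inspected w u)%:R +
    (b w - c w) * (above_all w u)%:R).
  have nb := ncopies_max_bounds w u0.
  rewrite /value_after /nice recordE ncopies_maxS distinctS /remaining ncopies_maxS.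
  rewrite /a /b /c /d /r /k /remaining.
  have [/eqP e|ne] := boolP (cand w u == maximal (inspected w u)).
    have old : cand w u \in inspected w u by rewrite e inspected_maximal.
    have -> : above_all w u = false by rewrite /above_all e ltnn.
    rewrite old /= addn0 subnS mulr1 !mulr0 !addr0 addrC subrK.
    by congr (if _ then _ else _); lia.
  have [ab|nab] := boolP (above_all w u).
    rewrite (above_all_new ab) /= (_ : (1 == m)%N = false); last by lia.
    by rewrite addn1 subn1; ring.
  by case: (boolP (_ \in _)) => _ /=; rewrite ?addn0 ?addn1; ring.
have ak : adapted u k := adapted_distinct (t := u).
have ar : adapted u r := adapted_remaining (t := u).
have az z : adapted u (fun w => g w * (z (k w) (r w) : R)).
  by move=> w w' s; rewrite (ag _ _ s) (ak _ _ s) (ar _ _ s).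
have M0 : (m * n - u)%:R != 0 :> R by rewrite pnatr_eq0 subn_eq0 -ltnNge.
under eq_bigr do rewrite value_afterE mulrDr.
rewrite big_split /=; rewrite -[RHS]addr0; congr (_ + _).
apply: (mulfI M0); rewrite mulr0.
under eq_bigr do rewrite !mulrDr !mulrA.
rewrite !big_split /= !mulrDr.
rewrite (@sum_copy_of_maximal (fun w => g w * (a w - d w))); last first.
  exact: (az (fun k r => (if r == 1%N then X k else W k r.-1) - W k r)).
rewrite (@sum_new (fun w => g w * (c w - d w))); last first.
  exact: (az (fun k r => W k.+1 r - W k r)).
rewrite (@sum_above_all (fun w => g w * (b w - c w))) //; last first.
  exact: (az (fun k r => W k.+1 m.-1 - W k.+1 r)).
rewrite -!big_split /= big1 // => w _.
have := bW.2 _ (distinct_bounds w u0) _ (remaining_ltn w u0).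
rewrite -/(k w) -/(r w) -/(a w) -/(d w) /new_candidate_mean -/(c w) -/(b w) => e.
transitivity (g w * ((r w)%:R * a w + m%:R * (n%:R - (k w)%:R) *
    (((k w)%:R * c w + b w) / (k w).+1%:R) - ((r w)%:R + m%:R * (n%:R - (k w)%:R)) * d w)).
  have k1 : (k w).+1%:R != 0 :> R by rewrite pnatr_eq0.
  have : (k w).+1%:R = (k w)%:R + 1 :> R by rewrite natr1.
  by move: _.+1%:R k1 => q q0 qE; move: q0; rewrite {}qE => q0; field.
by rewrite e subrr mulr0.
Qed.

End Chain.

(** * Values of stopping rules *)

Section Stopping.
Context {R : realType} {m n : nat}.
Hypotheses (m2 : (2 <= m)%N) (n0 : (0 < n)%N).
Implicit Types (w : 'S_(m * n)) (t : nat) (u : 'I_(m * n)) (g : 'S_(m * n) -> R).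
Implicit Types (D : 'I_(m * n) -> 'S_(m * n) -> bool).

Let m0 : (0 < m)%N := ltnW m2.
Let mn0 : (0 < m * n)%N. Proof. by rewrite muln_gt0 m0. Qed.

(** Common form of [success] (with [t = 0]) and [first_nice_success] (with [D] the nice candidates),
    started at any time so that induction on time is possible. *)
Definition stop_success D w t : bool :=
  [exists u : 'I_(m * n), [&& (t <= u)%N, D u w,
     [forall v : 'I_(m * n), (t <= v < u)%N ==> ~~ D v w] & is_best n (cand w u)]].

Lemma stop_success_end D w : stop_success D w (m * n) = false.
Proof. by apply/existsP => -[u /and4P[]]; rewrite leqNgt ltn_ord. Qed.

Lemma stop_successE D w u : stop_success D w u =
  if D u w then is_best n (cand w u) else stop_success D w u.+1.
Proof.
apply/existsP/idP => [[v /and4P[uv Dv /forallP h best]]|].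
  case: ifP => [Du|nDu].
    suff <- : v = u by [].
    apply/eqP; rewrite -val_eqE eqn_leq uv andbT leqNgt; apply/negP => uv'.
    by move: (h u); rewrite leqnn uv' Du.
  apply/existsP; exists v; rewrite Dv best andbT /=; apply/andP; split.
    rewrite ltn_neqAle uv andbT; apply: contraFneq nDu => /val_inj -> //.
  by apply/forallP => x; apply/implyP => /andP[ux xv]; move: (h x); rewrite (ltnW ux) xv.
case: ifP => [Du best|nDu /existsP[v /and4P[uv Dv /forallP h best]]].
  exists u; rewrite leqnn Du best andbT /=; apply/forallP => v.
  by apply/implyP => /andP[uv vu]; move: (leq_ltn_trans uv vu); rewrite ltnn.
exists v; rewrite (ltnW uv) Dv best andbT /=; apply/forallP => x.
apply/implyP => /andP[ux xv]; have [/val_inj <-|ne] := eqVneq (u : nat) x.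
  by rewrite nDu.
by move: (h x); rewrite ltn_neqAle ne ux xv.
Qed.

Lemma inspected_end w : distinct w (m * n) = n /\ remaining w (m * n) = 0%N.
Proof.
have all_copies c : (c < n)%N -> (m - count_mem c (inspected w (m * n)))%N = 0%N.
  move=> cn; rewrite -card_remaining //; apply: eq_card0 => u.
  by rewrite !inE leqNgt ltn_ord.
split; last exact/all_copies/maximal_inspected_ltn.
rewrite /distinct -(sum_mem_ndifferent (inspected_ltn m0 w _)).
rewrite (eq_bigr (fun=> 1%N)) ?sum1_card ?card_ord // => c _.
apply/eqP; rewrite eqb1; apply: contraT => h.
by have := all_copies c (ltn_ord c); rewrite (count_memPn h); lia.
Qed.

Lemma best_inspected w t : (n.-1 \in inspected w t) ->
  is_best n (maximal (inspected w t)).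
Proof.
move=> h; rewrite /is_best eqn_leq maximal_inspected_ltn //.
by rewrite -{1}(prednK n0) ltnS leq_maximal.
Qed.

Lemma is_bestE c : is_best n c = (c == n.-1).
Proof. by rewrite /is_best -{1}(prednK n0) eqSS. Qed.

(** Splits success into a visible event, being a record, and a hidden one, the best candidate having
    been inspected, to which [sum_best_inspected] applies. *)
Lemma record_best w u : is_best n (cand w u) =
  (cand w u == maximal (inspected w u.+1)) && (n.-1 \in inspected w u.+1).
Proof.
apply/idP/andP => [|[/eqP -> /best_inspected //]].
rewrite is_bestE => /eqP e; have h := mem_inspected w (ltnSn u).
split; last by rewrite -e.
rewrite eqn_leq leq_maximal //= e -ltnS prednK // maximal_inspected_ltn //.
Qed.

Lemma nice_remaining w u : nice w u -> remaining w u.+1 = 0%N.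
Proof. by case/andP => _ /eqP e; rewrite /remaining e subnn. Qed.

Lemma sum_stop_best g u (D : 'S_(m * n) -> bool) : adapted u.+1 g -> adapted u.+1 D ->
  (forall w, D w -> cand w u == maximal (inspected w u.+1)) ->
  \sum_w g w * (D w && is_best n (cand w u))%:R =
  \sum_w g w * ((D w)%:R * ((distinct w u.+1)%:R / n%:R)).
Proof.
move=> ag aD Dmax; have agD : adapted u.+1 (fun w => g w * (D w)%:R).
  by move=> w w' s; rewrite (ag _ _ s) (aD _ _ s).
transitivity (\sum_w g w * (D w)%:R * (n.-1 \in inspected w u.+1)%:R).
  apply: eq_bigr => w _; rewrite -mulrA -natrM mulnb record_best.
  by case: (boolP (D w)) => // /Dmax ->.
rewrite (sum_best_inspected m0 n0 agD); apply: eq_bigr => w _.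
by rewrite -mulrA.
Qed.

(** Backward induction in time: accepted objects earn k / n by [sum_stop_best], the rejecting orders
    are passed on with [g] restricted to them, and [one_step] turns the total into the value one
    inspection earlier. *)
Lemma policy_value (a : nat -> bool) X W g t :
    balanced m n X W ->
    (forall k, X k = if a k then k%:R / n%:R else W k 0%N) ->
    (1 <= t <= m * n)%N -> adapted t g ->
  \sum_w g w * (stop_success (fun u w => nice w u && a (distinct w u.+1)) w t)%:R =
  \sum_w g w * W (distinct w t) (remaining w t).
Proof.
move=> bW XE; have [j] := ubnP (m * n - t)%N.
elim: j t g => // j IH t g jt tN ag.
have [->|tN'] : t = (m * n)%N \/ (1 <= t < m * n)%N by lia.
  apply: eq_bigr => w _; rewrite stop_success_end.
  by have [-> ->] := inspected_end w; rewrite bW.1 mulr0.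
have [u ?] : exists u : 'I_(m * n), t = u by exists (Ordinal (andP tN').2).
subst t.
pose D w := nice w u && a (distinct w u.+1).
have aD : adapted u.+1 D.
  by move=> w w' s; rewrite /D (adapted_nice s) (adapted_distinct s).
have Dmax w : D w -> cand w u == maximal (inspected w u.+1).
  by case/andP => /andP[].
rewrite -(one_step m2 n0 (u := u) _ bW) //; last by case/andP: (tN').
have agu := @adaptedW _ _ _ _ _ _ (leqnSn u) ag.
transitivity (\sum_w g w * (D w && is_best n (cand w u))%:R +
   \sum_w (g w * (~~ D w)%:R) * (stop_success (fun u w => nice w u && a (distinct w u.+1)) w u.+1)%:R).
  rewrite -big_split; apply: eq_bigr => w _ /=.
  rewrite stop_successE -/(D w).
  by case: (D w); rewrite /= ?mulr1 ?mulr0 ?mul0r ?addr0 ?add0r.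
rewrite (@sum_stop_best g u D) // IH //; try lia; last first.
  by move=> w w' s; rewrite (agu _ _ s) (aD _ _ s).
rewrite -big_split; apply: eq_bigr => w _ /=.
rewrite /value_after /D; case: ifP => [nw|nw] /=.
  by rewrite XE (nice_remaining nw); case: (a _); rewrite /= !(mul1r, mulr1, mul0r, mulr0, addr0, add0r).
by rewrite mul0r mulr0 add0r mulr1.
Qed.

(** Verification argument by the same induction: at each inspection, accepting and rejecting are
    both worth at most [value_after]. *)
Lemma optimality X V D g t :
    balanced m n X V -> (forall k, (1 <= k <= n)%N -> k%:R / n%:R <= X k) ->
    (forall k, V k 0%N <= X k) ->
    (forall u, adapted u.+1 (D u)) -> (forall w, 0 <= g w) ->
    (1 <= t <= m * n)%N -> adapted t g ->
  \sum_w g w * (stop_success D w t)%:R <=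
  \sum_w g w * V (distinct w t) (remaining w t).
Proof.
move=> bV Xge XV aD; have [j] := ubnP (m * n - t)%N.
have V0 w t' : (0 < t')%N -> 0 <= V (distinct w t') (remaining w t').
  by move=> h; exact: (balanced_ge0 m2 n0 bV Xge (distinct_bounds m2 n0 w h) (remaining_ltn m2 n0 w h)).
elim: j t g => // j IH t g jt g0 tN ag.
have [->|tN'] : t = (m * n)%N \/ (1 <= t < m * n)%N by lia.
  apply: ler_sum => w _; rewrite stop_success_end mulr0 mulr_ge0 // V0 //.
have [u ?] : exists u : 'I_(m * n), t = u by exists (Ordinal (andP tN').2).
subst t.
(* Accepting an object that is not a record always fails, so only [A] can earn anything. *)
pose A w := D u w && (cand w u == maximal (inspected w u.+1)).
have aA : adapted u.+1 A.
  by move=> w w' s; rewrite /A (aD _ _ _ s) (adapted_record s).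
have Amax w : A w -> cand w u == maximal (inspected w u.+1) by case/andP.
rewrite -(one_step m2 n0 (u := u) _ bV) //; last by case/andP: (tN').
have agu := @adaptedW _ _ _ _ _ _ (leqnSn u) ag.
have -> : \sum_w g w * (stop_success D w u)%:R =
   \sum_w g w * (A w && is_best n (cand w u))%:R +
   \sum_w (g w * (~~ D u w)%:R) * (stop_success D w u.+1)%:R.
  rewrite -big_split; apply: eq_bigr => w _ /=.
  rewrite stop_successE /A record_best.
  by case: (D u w); case: (_ == maximal _); rewrite /= ?mulr1 ?mulr0 ?mul0r ?addr0 ?add0r.
rewrite (@sum_stop_best g u A) //.
apply: (@le_trans _ _ (\sum_w g w * ((A w)%:R * ((distinct w u.+1)%:R / n%:R)) +
    \sum_w (g w * (~~ D u w)%:R) * V (distinct w u.+1) (remaining w u.+1))).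
  rewrite lerD2l; apply: IH; try lia.
    by move=> w; rewrite mulr_ge0.
  by move=> w w' s; rewrite (agu _ _ s) (aD _ _ _ s).
rewrite -big_split; apply: ler_sum => w _ /=.
rewrite -mulrA -mulrDr ler_wpM2l // /value_after /A.
have db := distinct_bounds m2 n0 w (ltn0Sn u).
have rb := remaining_ltn m2 n0 w (ltn0Sn u).
case: ifP => [nw|nw].
  rewrite nice_remaining //.
  have -> : cand w u == maximal (inspected w u.+1) by case/andP: nw.
  by case: (D u w); rewrite /= ?mul1r ?mul0r ?addr0 ?add0r ?Xge ?XV.
case: (D u w) => /=; last by rewrite mul0r add0r mul1r.
rewrite mul0r addr0; case: eqP => [e|_]; last by rewrite mul0r V0.
(* A record that is not nice has copies to come, so waiting is worth at least k / n. *)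
have r0 : (0 < remaining w u.+1)%N.
  move: nw; rewrite /nice e eqxx /=.
  by have := ncopies_max_bounds m2 n0 w (ltn0Sn u); rewrite /remaining; lia.
by have := balanced_ge m2 n0 bV Xge db rb; rewrite r0.
Qed.


Lemma natr_card (T : finType) (A : pred T) : #|A|%:R = \sum_x (A x)%:R :> R.
Proof. by rewrite -sum1_card big_mkcond natr_sum; apply: eq_bigr => x _; rewrite unfold_in; case: (A x). Qed.

Lemma inspected1 w u : u = 0%N :> nat -> inspected w u.+1 = [:: cand w u].
Proof. by move=> u0; rewrite inspectedS u0 /inspected take0. Qed.

Lemma first_state w : distinct w 1 = 1%N /\ remaining w 1 = m.-1.
Proof.
have := @inspected1 w (Ordinal mn0) erefl; rewrite /= => e.
by rewrite /distinct /remaining e /ncopies_max /maximal big_seq1 /= eqxx addn0 subn1.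
Qed.

Lemma first_record w u : u = 0%N :> nat -> cand w u == maximal (inspected w u.+1).
Proof. by move=> u0; rewrite inspected1 // /maximal big_seq1. Qed.

Lemma first_not_nice w u : u = 0%N :> nat -> nice w u = false.
Proof.
move=> u0; rewrite /nice inspected1 // /ncopies_max /maximal big_seq1 /= eqxx addn0.
by apply/negP => /eqP; lia.
Qed.

(** The first inspection is treated apart, because there is no state before it: accepting earns 1 /
    n, which is at most [V 1 m.-1], and rejecting leads to state (1, 1). *)
Lemma optimal_success_value : optimal_success R m n = optimal_value m n 1 m.-1.
Proof.
pose V := optimal_value (R := R) m n.
pose X k : R := Num.max (k%:R / n%:R) (V k 0%N).
have bV : balanced m n X V by exact: optimal_balanced.
have Xge k : (1 <= k <= n)%N -> k%:R / n%:R <= X k by move=> _; rewrite le_max lexx.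
have XV k : V k 0%N <= X k by rewrite le_max lexx orbT.
have s0 : 0 < #|{: 'S_(m * n)}|%:R :> R by rewrite ltr0n; apply/card_gt0P; exists 1%g.
have V1 : 1 / n%:R <= V 1%N m.-1.
  have := @balanced_ge R m n X V m2 n0 bV Xge 1 m.-1; rewrite mul1r.
  by rewrite (_ : (0 < m.-1)%N = true) ?mul1r; [apply; lia|lia].
have total : \sum_(w : 'S_(m * n)) V 1%N m.-1 = V 1%N m.-1 * #|{: 'S_(m * n)}|%:R.
  by rewrite sumr_const mulr_natr.
pose u0 : 'I_(m * n) := Ordinal mn0.
have successE (d : decision m n) w : success d w = stop_success (fun u w => d (u, w)) w 0.
  by apply: eq_existsb => u; rewrite leq0n.
apply/eqP; rewrite eq_le; apply/andP; split.
  apply: bigmax_le => [|d /forallP sd].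
    by apply: le_trans V1; rewrite divr_ge0.
  rewrite /Pr ler_pdivrMr // natr_card -total.
  pose D u w := d (u, w).
  have aD u : adapted u.+1 (D u).
    move=> w w' s; apply/eqP; move: (sd u) => /forallP/(_ w)/forallP/(_ w')/implyP; apply.
    apply/forallP => a; apply/forallP => b; apply/implyP => /andP[au bu].
    by rewrite s.
  have -> : \sum_w (success d w)%:R = \sum_w 1 * (D u0 w && is_best n (cand w u0))%:R +
      \sum_w (~~ D u0 w)%:R * (stop_success D w 1)%:R :> R.
    rewrite -big_split; apply: eq_bigr => w _ /=; rewrite successE.
    by rewrite -[0%N]/(val u0) stop_successE -/(D u0 w); case: (D u0 w);
      rewrite /= !(mul1r, mul0r, addr0, add0r).
  rewrite (@sum_stop_best (fun=> 1) u0 (D u0)) //; last by move=> w _; exact: first_record.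
  have := @optimality X V D (fun w => (~~ D u0 w)%:R) 1 bV Xge XV aD.
  move=> /(_ (fun w => ler0n _ _)); rewrite mn0 => /(_ isT) opt.
  apply: le_trans (lerD (lexx _) (opt _)) _.
    by move=> w w' s; rewrite (aD u0 _ _ s).
  rewrite -big_split; apply: ler_sum => w _ /=.
  have [-> ->] := first_state w.
  by move: V1; rewrite div1r => V1; case: (D u0 w); rewrite /= !(mul1r, mul0r, addr0, add0r).
(* The value is attained by accepting a nice candidate exactly when waiting is worth at most k /
   n. *)
pose a k := V k 0%N <= k%:R / n%:R.
pose d : decision m n := [ffun p => nice p.2 p.1 && a (distinct p.2 p.1.+1)].
apply: (bigmax_sup d).
  apply/forallP => u; apply/forallP => w; apply/forallP => w'; apply/implyP => s.
  have s' : same_prefix u.+1 w w'.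
    move=> x y xu yu; move: s => /forallP/(_ x)/forallP/(_ y)/implyP h.
    have xyu : ((x <= u) && (y <= u))%N by apply/andP; split; [exact: xu|exact: yu].
    exact: (eqP (h xyu)).
  by rewrite !ffunE /= (adapted_nice s') (adapted_distinct s').
rewrite /Pr ler_pdivlMr // -total natr_card.
have XE k : X k = if a k then k%:R / n%:R else V k 0%N.
  by rewrite /X /a; case: leP.
have := @policy_value a X V (fun=> 1) 1 bV XE; rewrite mn0 => /(_ isT) pv.
have -> : \sum_(w : 'S_(m * n)) V 1%N m.-1 =
    \sum_(w : 'S_(m * n)) 1 * V (distinct w 1) (remaining w 1).
  by apply: eq_bigr => w _; have [-> ->] := first_state w; rewrite mul1r.
rewrite -pv //; apply: ler_sum => w _; rewrite mul1r successE.
have dE u v : d (u, v) = nice v u && a (distinct v u.+1) by rewrite ffunE.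
have -> : stop_success (fun u w => d (u, w)) w 0 =
    stop_success (fun u w => nice w u && a (distinct w u.+1)) w 0.
  by apply: eq_existsb => u; rewrite dE; congr [&& _, _, _ & _];
    apply: eq_forallb => v; rewrite dE.
(* As m >= 2, the first object is never nice, so starting at time 0 or at time 1 is the same. *)
by rewrite -[0%N]/(val u0) stop_successE first_not_nice.
Qed.

(** * Reachable states and the probabilities [Phi] *)

Lemma exists_unique_sum M (P : pred 'I_M) :
    (forall t t' : 'I_M, (t < t')%N -> P t -> P t' -> False) ->
  ([exists t, P t])%:R = \sum_t (P t)%:R :> R.
Proof.
move=> uP; have [/existsP[t Pt]|/existsPn nP] := boolP [exists t, P t].
  rewrite (bigD1 t) //= Pt big1 ?addr0 // => t' tt'.
  have [/(uP _ _)h|/(uP _ _)h|/val_inj e] := ltngtP t' t.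
  - by case: (boolP (P t')) => // /h; case/(_ Pt).
  - by case: (boolP (P t')) => // /(h Pt).
  by move: tt'; rewrite e eqxx.
by rewrite big1 // => t _; rewrite (negbTE (nP t)).
Qed.

Lemma in_stateE k i w t : in_state k i (inspected w t) ->
  distinct w t = k /\ remaining w t = (m - i)%N.
Proof. by case/andP => /eqP dk /eqP ci; rewrite /distinct /remaining dk ci. Qed.

Lemma adapted_in_state k i t : adapted t (fun w => in_state k i (inspected w t)).
Proof.
by move=> w w' s; rewrite /in_state (adapted_ncopies_max s) (adapted_ndifferent s).
Qed.

Lemma adapted_enters k i t : adapted t (fun w => enters k i w t).
Proof.
move=> w w' s; rewrite /enters (@adapted_in_state k i _ _ _ s); congr (_ && _).
apply: eq_forallb => u; congr (~~ _); apply: (@adapted_in_state k i u).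
by move=> a b au bu; apply: s; apply: ltn_trans (ltn_ord u).
Qed.

Definition reachable k i : Prop := exists (w : 'S_(m * n)) (t : nat),
  (1 <= t <= m * n)%N /\ in_state k i (inspected w t).

(** If no order in this state had a copy of the maximal candidate next, [sum_copy_of_maximal] would
    equate 0 with a positive sum. *)
Lemma reachable_copy k i : (i < m)%N -> reachable k i -> reachable k i.+1.
Proof.
move=> im [w0 [t [tN st0]]].
have tN' : (t < m * n)%N.
  rewrite ltn_neqAle; case/andP: (tN) => _ ->; rewrite andbT; apply/eqP => e.
  by have := (in_stateE st0).2; rewrite e (inspected_end w0).2; lia.
case/andP: (tN) => t0 _.
pose u := Ordinal tN'; pose g w : R := (in_state k i (inspected w u))%:R.
have ag : adapted u g by move=> w w' s; rewrite /g (@adapted_in_state k i _ _ _ s).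
have := sum_copy_of_maximal m2 n0 ag.
have [/existsP[w /andP[sw /eqP e]] _|/existsPn no] :=
    boolP [exists w, in_state k i (inspected w u) && (cand w u == maximal (inspected w u))].
  exists w, u.+1; split; first by rewrite /= tN'.
  case/andP: (sw) => dk ci; rewrite /in_state ncopies_maxS e eqxx (eqP ci) eqxx andbT.
  rewrite -/(distinct w u.+1) distinctS e inspected_maximal //= addn0 //.
rewrite big1 ?mulr0; last first.
  by move=> w _; rewrite /g -natrM mulnb (negbTE (no w)).
move=> /esym/eqP; rewrite psumr_eq0 => [/allP/(_ w0)|w _]; last by rewrite mulr_ge0.
rewrite mem_index_enum /g st0 mul1r pnatr_eq0 (in_stateE st0).2 => /(_ isT).
by rewrite /= => /eqP; lia.
Qed.

(** A new candidate fails to become maximal with probability k / (k + 1) > 0. Otherwise [sum_new]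
    and [sum_above_all] would agree, although they differ by the nonzero factor 1 / (k + 1). *)
Lemma reachable_new k i : (k < n)%N -> reachable k i -> reachable k.+1 i.
Proof.
move=> kn [w0 [t [tN st0]]].
have tN' : (t < m * n)%N.
  rewrite ltn_neqAle; case/andP: (tN) => _ ->; rewrite andbT; apply/eqP => e.
  by have := (in_stateE st0).1; rewrite e (inspected_end w0).1; lia.
case/andP: (tN) => t0 _.
pose u := Ordinal tN'; pose g w : R := (in_state k i (inspected w u))%:R.
have ag : adapted u g by move=> w w' s; rewrite /g (@adapted_in_state k i _ _ _ s).
have enew := sum_new m2 ag; have eabove := sum_above_all m2 n0 (u := u) t0 ag.
have [/existsP[w /and3P[sw new nab]]|/existsPn no] :=
    boolP [exists w, [&& in_state k i (inspected w u),
       cand w u \notin inspected w u & ~~ above_all w u]].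
  exists w, u.+1; split; first by rewrite /= tN'.
  case/andP: (sw) => dk ci; rewrite /in_state ncopies_maxS (negbTE nab).
  have -> : (cand w u == maximal (inspected w u)) = false.
    by apply: contraNF new => /eqP ->; apply: inspected_maximal.
  by rewrite ci andbT -/(distinct w u.+1) distinctS new addn1 eqSS.
have e : \sum_w g w * (cand w u \notin inspected w u)%:R = \sum_w g w * (above_all w u)%:R.
  apply: eq_bigr => w _; have := no w; rewrite /g.
  have [|_] := boolP (in_state _ _ _); last by rewrite !mul0r.
  have [ab|nab] := boolP (above_all w u); first by rewrite (above_all_new ab).
  by rewrite andbT /= negbK => _ ->.
move: enew; rewrite e eabove => /eqP; rewrite -subr_eq0 -sumrB.
under eq_bigr => w _.
  have -> : g w * (m%:R * (n%:R - (distinct w u)%:R) / (distinct w u).+1%:R) -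
      g w * (m%:R * (n%:R - (distinct w u)%:R)) =
      - (g w * (m%:R * (n%:R - k%:R) * (1 - k.+1%:R^-1))).
    rewrite /g; have [/in_stateE[-> _]|_] := boolP (in_state _ _ _); last by rewrite !mul0r; ring.
    by ring.
  over.
rewrite sumrN oppr_eq0 -mulr_suml mulf_eq0; case/orP; last first.
  have k1 : (1 <= k)%N.
    by have [dk _] := in_stateE st0; case/andP: (distinct_bounds m2 n0 w0 t0); rewrite dk.
  have nz : 1 - k.+1%:R^-1 != 0 :> R.
    by rewrite subr_eq0 eq_sym invr_eq1 (eqr_nat R k.+1 1) eqSS -lt0n.
  rewrite !mulf_eq0 (negbTE nz) orbF pnatr_eq0 subr_eq0 eqr_nat.
  by rewrite (gtn_eqF kn) (gtn_eqF m0).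
rewrite psumr_eq0 => [/allP/(_ w0)|w _]; last exact: ler0n.
by rewrite mem_index_enum /g st0 oner_eq0 => /(_ isT).
Qed.

Lemma reachable_all k i : (1 <= k <= n)%N -> (1 <= i <= m)%N -> reachable k i.
Proof.
move=> kn im; have r11 : reachable 1 1.
  exists (1%g : 'S_(m * n)), 1%N; split; first by rewrite mn0.
  have := @inspected1 (1%g : 'S_(m * n)) (Ordinal mn0) erefl; rewrite /= => ->.
  by rewrite /in_state /ndifferent /ncopies_max /maximal big_seq1 /= eqxx.
have rk j : (j < n)%N -> reachable j.+1 1.
  by elim: j => // j IH jn; apply: reachable_new => //; apply: IH; lia.
have ri j : (j < m)%N -> reachable k j.+1.
  elim: j => [|j IH] jm; last by apply: reachable_copy; [lia|apply: IH; lia].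
  by rewrite -(prednK (_ : 0 < k)%N); [apply: rk; lia|lia].
by rewrite -(prednK (_ : 0 < i)%N); [apply: ri; lia|lia].
Qed.

(** The time of entry is unique and visible, so both probabilities split over it, and [policy_value]
    with the indicator of entry as weight yields the same factor at every time. *)
Lemma PhiE i k : (1 <= k <= n)%N -> (1 <= i <= m)%N ->
  Phi R m n i k = first_nice_value m n k (m - i).
Proof.
move=> kn im; set F := first_nice_value m n.
have bF : balanced m n (fun k => k%:R / n%:R) F by exact: first_nice_balanced.
have uniq (w : 'S_(m * n)) (t t' : 'I_(m * n).+1) : (t < t')%N ->
    enters k i w t -> enters k i w t' -> False.
  by move=> tt' /andP[st _] /andP[_ /forallP/(_ (Ordinal tt'))]; rewrite st.
have step (t : 'I_(m * n).+1) :
    \sum_(w : 'S_(m * n)) (enters k i w t && first_nice_success w t)%:R =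
    (\sum_(w : 'S_(m * n)) (enters k i w t)%:R) * F k (m - i)%N.
  rewrite mulr_suml.
  have [t0|t0] := posnP t.
    apply: eq_bigr => w _; rewrite (_ : enters k i w t = false) ?mul0r //.
    rewrite /enters /in_state t0 /inspected take0 /ndifferent /=.
    by rewrite (_ : (0 == k)%N = false) //; lia.
  have := @policy_value xpredT _ F (fun w => (enters k i w t)%:R) t bF (fun=> erefl).
  have tN : (1 <= t <= m * n)%N by rewrite t0 -ltnS ltn_ord.
  have ae : adapted t (fun w => (enters k i w t)%:R : R).
    by move=> w w' s; rewrite (adapted_enters _ _ s).
  move=> /(_ tN ae) e.
  transitivity (\sum_w (enters k i w t)%:R *
      (stop_success (fun u w => nice w u && xpredT (distinct w u.+1)) w t)%:R : R).
    apply: eq_bigr => w _; rewrite -natrM mulnb; congr ((_ && _)%:R).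
    by apply: eq_existsb => u; rewrite andbT; congr [&& _, _, _ & _];
      apply: eq_forallb => v; rewrite andbT.
  rewrite e; apply: eq_bigr => w _.
  have [/andP[/in_stateE[-> ->]] //|_] := boolP (enters k i w t).
  by rewrite !mul0r.
rewrite /Phi /cPr /Pr !natr_card.
have -> : \sum_(w : 'S_(m * n)) ([exists t : 'I_(m * n).+1, enters k i w t])%:R =
    \sum_(t < (m * n).+1) \sum_(w : 'S_(m * n)) (enters k i w t)%:R :> R.
  by rewrite exchange_big /=; apply: eq_bigr => w _; rewrite exists_unique_sum //; exact: uniq.
set B := \sum_(t < _) _.
rewrite (_ : \sum_w _ = B * F k (m - i)%N); last first.
  transitivity (\sum_(t < (m * n).+1) \sum_(w : 'S_(m * n))
      (enters k i w t && first_nice_success w t)%:R : R); last first.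
    by rewrite mulr_suml; apply: eq_bigr => t _; rewrite step.
  rewrite exchange_big /=.
  apply: eq_bigr => w _; rewrite -exists_unique_sum; last first.
    by move=> t t' tt' /andP[et _] /andP[et' _]; exact: (uniq w t t').
  congr (_%:R); apply: congr1; apply/andP/idP => [[] //|h]; split => //.
  by move/existsP: h => [t /andP[et _]]; apply/existsP; exists t.
(* The first visit to the state, along an order given by [reachable_all], makes the denominator
   positive. *)
have Bn0 : B != 0.
  have [w [t [tN st]]] := reachable_all kn im.
  have ex : exists t, in_state k i (inspected w t) by exists t.
  case: (ex_minnP ex) => t' st' mint'.
  have t'N : (t' < (m * n).+1)%N by rewrite ltnS (leq_trans (mint' _ st)) //; case/andP: tN.
  have ent : enters k i w t'.
    by rewrite /enters st'; apply/forallP => u; apply: contraL (ltn_ord u) => /mint'; rewrite -leqNgt.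
  rewrite psumr_neq0; last by move=> ? _; apply: sumr_ge0 => ? _; exact: ler0n.
  apply/hasP; exists (Ordinal t'N); rewrite ?mem_index_enum //=.
  rewrite lt_neqAle eq_sym psumr_neq0; last by move=> ? _; exact: ler0n.
  rewrite sumr_ge0 ?andbT; last by move=> ? _; exact: ler0n.
  by apply/hasP; exists w; rewrite ?mem_index_enum //= ent ltr01.
have Sn0 : (\sum_(x : 'S_(m * n)) (predT x)%:R : R) != 0.
  by rewrite -natr_card pnatr_eq0 -lt0n; apply/card_gt0P; exists 1%g.
move: Sn0; set S := \sum_x _ => Sn0.
by field; rewrite Bn0 Sn0.
Qed.

End Stopping.

(** * Limits *)

Section Analysis.
Context {R : realType}.

(** Young's inequality for x ^ p and 1 with exponents 1 / p and 1 / (1 - p). *)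
Lemma powR_bernoulli (p x : R) : 0 <= p <= 1 -> 0 <= x ->
  x `^ p <= 1 + p * (x - 1).
Proof.
move=> /andP[p0 p1] x0.
have [->|pn0] := eqVneq p 0; first by rewrite powRr0 mul0r addr0.
have [->|pn1] := eqVneq p 1; first by rewrite powRr1 // mul1r addrC subrK.
have p0' : 0 < p by rewrite lt_neqAle eq_sym pn0.
have p1' : 0 < 1 - p by rewrite subr_gt0 lt_neqAle pn1.
have := @conjugate_powR R (x `^ p) 1 p^-1 (1 - p)^-1 (powR_ge0 _ _) ler01.
rewrite !invr_gt0 !invrK => /(_ p0' p1').
rewrite addrC subrK => /(_ erefl).
rewrite mulr1 powR1 mul1r -powRrM mulfV // powRr1 // => h.
by apply: le_trans h _; rewrite le_eqVlt; apply/orP; left; apply/eqP; ring.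
Qed.

(** Bernoulli's inequality at (a - 1) / a and at (a + 1) / a; both bounds telescope over consecutive
    values of [a]. *)
Lemma factor_bounds (p a : R) : 0 <= p <= 1 -> 1 <= a ->
  ((a - 1) / a) `^ p <= a / (a + p) <= (a / (a + 1)) `^ p.
Proof.
move=> p01 a1; have /andP[p0 p1] := p01.
have a0 : 0 < a by apply: lt_le_trans a1.
have ap : 0 < a + p by rewrite ltr_pwDl.
have aa : 0 < a + 1 by rewrite ltr_pwDl.
apply/andP; split.
  have x0 : 0 <= (a - 1) / a by rewrite divr_ge0 ?subr_ge0 // ltW.
  apply: le_trans (powR_bernoulli p01 x0) _.
  rewrite ler_pdivlMr // -subr_ge0.
  have -> : a - (1 + p * ((a - 1) / a - 1)) * (a + p) = p ^+ 2 / a.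
    by field; rewrite gt_eqF.
  by rewrite divr_ge0 ?sqr_ge0 // ltW.
have x0 : 0 <= (a + 1) / a by rewrite divr_ge0 // ltW.
have := powR_bernoulli p01 x0.
have -> : 1 + p * ((a + 1) / a - 1) = (a + p) / a by field; rewrite gt_eqF.
have y0 : 0 <= a / (a + 1) by rewrite divr_ge0 // ltW.
have yp : 0 < (a / (a + 1)) `^ p by rewrite powR_gt0 // divr_gt0.
rewrite -(ler_pM2l yp) -powRM //.
have -> : a / (a + 1) * ((a + 1) / a) = 1 by field; rewrite !gt_eqF.
by rewrite powR1 mulrA ler_pdivlMr // mul1r -ler_pdivrMr.
Qed.

Lemma prod_ratio_bounds (p : R) (n K : nat) : 0 <= p <= 1 -> (1 <= K <= n)%N ->
  ((n%:R - K%:R) / n%:R) `^ p <=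
  \prod_(1 <= j < K) ((n%:R - j%:R) / (n%:R - j%:R + p)) <=
  ((n%:R - K%:R + 1) / n%:R) `^ p.
Proof.
move=> p01; elim: K => // K IH Kn.
have nR : 0 < n%:R :> R by rewrite ltr0n; lia.
have [->|K0] := posnP K.
  rewrite big_geq // subrK divff ?gt_eqF // powR1 lexx andbT.
  have e1 : (1 : R) `^ p = 1 by rewrite powR1.
  rewrite -[X in _ <= X]e1.
  apply: ge0_ler_powR; rewrite ?nnegrE; try (by case/andP: p01).
  - by rewrite divr_ge0 // subr_ge0 ler1n -(ltr0n R).
  - by rewrite ler_pdivrMr // mul1r gerBl.
have KnR : 1 <= n%:R - K%:R :> R by rewrite lerBrDr addrC natr1 ler_nat; lia.
have a0 : 0 < n%:R - K%:R :> R by apply: lt_le_trans KnR.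
rewrite big_nat_recr //=.
have /andP[l1 u1] := IH ltac:(lia); have /andP[l2 u2] := factor_bounds p01 KnR.
set a := n%:R - K%:R in KnR a0 l1 u1 l2 u2 *.
have eK : n%:R - K.+1%:R = a - 1 :> R by rewrite /a -natr1; ring.
have aa : 0 < a + 1 by rewrite ltr_pwDl.
apply/andP; split.
  apply: le_trans (ler_pM (powR_ge0 _ _) (powR_ge0 _ _) l1 l2).
  rewrite -powRM ?divr_ge0 ?(ltW a0) ?(ltW nR) ?subr_ge0 //.
  by rewrite eK (_ : a / n%:R * ((a - 1) / a) = (a - 1) / n%:R) //; field; rewrite !gt_eqF.
apply: le_trans (ler_pM _ _ u1 u2) _.
- rewrite big_seq; apply: prodr_ge0 => i; rewrite mem_index_iota => /andP[_ iK].
  have : 0 <= n%:R - i%:R :> R by rewrite subr_ge0 ler_nat (leq_trans (ltnW iK)) // ltnW //; case/andP: Kn.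
  by case/andP: p01 => p0 _ h; rewrite divr_ge0 // addr_ge0.
- case/andP: p01 => p0 _; apply: divr_ge0; first exact: ltW.
  by rewrite ltW // ltr_pwDl.
rewrite -powRM ?divr_ge0 ?(ltW a0) ?(ltW nR) ?(ltW aa) //.
by rewrite eK subrK (_ : (a + 1) / n%:R * (a / (a + 1)) = a / n%:R) //; field; rewrite !gt_eqF.
Qed.

Lemma cvg_powR (u : nat -> R) (l p : R) : 0 < l ->
  u @ \oo --> l -> (fun n => u n `^ p) @ \oo --> l `^ p.
Proof.
move=> l0 ul.
have e : \forall n \near \oo, expR (p * ln (u n)) = u n `^ p.
  near=> n; rewrite /powR gt_eqF //; near: n.
  by apply: (cvgr_gt _ ul).
apply: (cvg_trans (near_eq_cvg e)).
rewrite [l `^ p]/powR gt_eqF //.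
apply: (@continuous_cvg _ _ _ _ _ (fun n => p * ln (u n)) expR (p * ln l)).
  exact: continuous_expR.
apply: cvgMr; apply: (@continuous_cvg _ _ _ _ _ u (@ln R) l) => //.
exact: continuous_ln.
Unshelve. all: by end_near. Qed.

(** Lets the argument move with [n], as the threshold does: uniformity controls [f n] at the moving
    point, continuity controls the motion. *)
Lemma uniform_cvg_at (f : nat -> R -> R) (Y : R -> R) (A : set R) (x : nat -> R) (l : R) :
  {uniform A, f @ \oo --> Y} -> {within A, continuous Y} ->
  A l -> (\forall n \near \oo, A (x n)) -> x @ \oo --> l ->
  (fun n => f n (x n)) @ \oo --> Y l.
Proof.
move=> fY cY Al Ax xl; apply/cvgrPdist_lt => e e0.
have e2 : 0 < e / 2 by rewrite divr_gt0.
have close : \forall n \near \oo, forall y, A y -> `|Y y - f n y| < e / 2.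
  apply: (fY [set h | forall y, A y -> `|Y y - h y| < e / 2]).
  apply/uniform_nbhs; exists [set xy | ball xy.1 (e / 2) xy.2]; split => //.
  exact: (entourage_ball _ (PosNum e2)).
have Yx : \forall n \near \oo, `|Y l - Y (x n)| < e / 2.
  have /subspace_continuousP/(_ l Al)/cvgrPdist_lt/(_ _ e2) h := cY.
  have := xl _ h; rewrite !near_simpl => h'.
  by apply: filterS2 Ax h' => n An; apply.
apply: filterS3 Ax close Yx => n An cn Yn.
rewrite (_ : Y l - _ = (Y l - Y (x n)) + (Y (x n) - f n (x n))); last by ring.
apply: le_lt_trans (ler_normD _ _) _.
by rewrite [ltRHS](splitr e) ltrD // cn.
Qed.

End Analysis.

(** With [y] the m-th root of 1 - x, this is the binomial law for [m] copies, each seen with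
    probability 1 - y, conditioned on seeing at least one, since 1 - y ^ m = x. *)
Lemma z_binomial (R : realType) (m i : nat) (x : R) : (1 <= i <= m)%N -> 0 < x < 1 ->
  let y := (1 - x) `^ m%:R^-1 in
  z m i x = 'C(m, i)%:R * y ^+ (m - i) * (1 - y) ^+ i / x.
Proof.
move=> /andP[i1 im] /andP[x0 x1] y.
have mR : m%:R != 0 :> R by rewrite pnatr_eq0; lia.
have x1' : 0 < 1 - x by rewrite subr_gt0.
have y0 : 0 < y by exact: powR_gt0.
have xn0 : x != 0 by exact: lt0r_neq0.
have yE j : (1 - x) `^ (j%:R / m%:R) = y ^+ j.
  by rewrite mulrC powRrM powR_mulrn // ltW.
have ym : 1 - x = y ^+ m by rewrite -yE divff // powRr1 // ltW.
rewrite /z (negbTE xn0).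
have [->|i1'] := eqVneq i 1%N.
  rewrite powRN -/y bin1 expr1 ym.
  have -> : y ^+ m = y ^+ (m - 1) * y by rewrite -exprSr subn1 prednK // (leq_trans i1).
  by move: (y ^+ (m - 1)) => v; field; rewrite xn0 gt_eqF.
have eE : (m%:R - i%:R) / m%:R = (m - i)%:R / m%:R :> R by rewrite natrB.
have [e|i2] := eqVneq i 2%N.
  rewrite -/y; move: eE; rewrite e => ->; rewrite yE.
  have -> : 'C(m, 2)%:R = m%:R * (m%:R - 1) / 2 :> R.
    apply: (@mulIf _ 2); rewrite ?pnatr_eq0 // divfK ?pnatr_eq0 //.
    have m0 : (0 < m)%N by rewrite (leq_trans i1).
    by rewrite -[1 in RHS]/(1%:R) -natrB // -!natrM mulnC -(mul_bin_diag m 1) bin1 subn1.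
  by field.
rewrite eE.
rewrite -/y yE.
(* The signs combine to an even power of -1, with exponent i + i ^ 2. *)
have -> : ((-1) ^+ i * (-1 + y)) ^+ i = (1 - y) ^+ i.
  rewrite (_ : -1 + y = -1 * (1 - y)); last by ring.
  rewrite mulrA -exprSr exprMn -exprM mulSn (_ : (-1) ^+ (i + i * i) = 1 :> R) ?mul1r //.
  by rewrite -signr_odd oddD oddM andbb addbb.
have -> : 'C(m, i)%:R = m`!%:R / (i`!%:R * (m - i)`!%:R) :> R.
  by rewrite -(bin_fact im) natrM natrM mulfK // mulf_neq0 // pnatr_eq0 -lt0n fact_gt0.
field; rewrite xn0 !pnatr_eq0 -!lt0n !fact_gt0 //.
Qed.

(** * The limit functions and the fixed point of [Y m] *)

Section Limits.
Context {R : realType} (m : nat).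
Hypothesis m2 : (2 <= m)%N.

Local Notation F n := (first_nice_value (R := R) m n).

Definition scaled_level (n : nat) (x : R) : nat := maxn 1 (Num.truncn (x * n%:R)).

Lemma scaled_level_bounds n x : (0 < n)%N -> 0 <= x <= 1 ->
  (1 <= scaled_level n x <= n)%N.
Proof.
move=> n0 /andP[x0 x1]; rewrite /scaled_level leq_maxl geq_max n0 /=.
rewrite truncn_le_nat -natr1; apply: (@le_lt_trans _ _ n%:R); last by rewrite ltrDl.
by rewrite ler_piMl.
Qed.

Lemma scaled_level_nat n k : (1 <= k <= n)%N -> scaled_level n (k%:R / n%:R) = k.
Proof.
move=> kn; have nR : n%:R != 0 :> R by rewrite pnatr_eq0; lia.
by rewrite /scaled_level divfK // natrK; apply/maxn_idPr; lia.
Qed.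

Lemma le_scaled_level n x y : x <= y -> (scaled_level n x <= scaled_level n y)%N.
Proof.
move=> xy; rewrite /scaled_level geq_max leq_maxl leq_max le_truncn ?orbT //.
by rewrite ler_wpM2r.
Qed.

Lemma phiE i n x : (0 < n)%N -> (1 <= i <= m)%N -> 0 <= x <= 1 ->
  phi m i n x = F n (scaled_level n x) (m - i).
Proof.
by move=> n0 im x01; rewrite /phi /scaled PhiE // scaled_level_bounds.
Qed.

Lemma cvg_invn : (fun n => n%:R^-1 : R) @ \oo --> (0 : R).
Proof. by rewrite -cvg_shiftS; exact: cvg_harmonic. Qed.

Lemma near_pos : \forall n \near \oo, (0 < n)%N.
Proof. by exists 1%N. Qed.

Lemma cvg_scaled_level x : 0 <= x <= 1 ->
  (fun n => (scaled_level n x)%:R / n%:R : R) @ \oo --> x.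
Proof.
move=> /andP[x0 x1].
apply: (@squeeze_cvgr _ _ _ _ (fun n => x - n%:R^-1) (fun n => x + n%:R^-1)); last 2 first.
- by rewrite -[X in _ --> X]subr0; apply: cvgB; [exact: cvg_cst|exact: cvg_invn].
- by rewrite -[X in _ --> X]addr0; apply: cvgD; [exact: cvg_cst|exact: cvg_invn].
near=> n.
have n0 : (0 < n)%N by near: n; exact: near_pos.
have nR : 0 < n%:R :> R by rewrite ltr0n.
have xn : 0 <= x * n%:R by rewrite mulr_ge0 // ltW.
have /andP[l u] := truncn_itv xn.
apply/andP; split.
  rewrite ler_pdivlMr // mulrBl mulVf ?gt_eqF // lerBlDr natr1.
  apply: le_trans (ltW u) _; rewrite ler_nat ltnS leq_maxr //.
rewrite ler_pdivrMr // mulrDl mulVf ?gt_eqF // natr_max.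
by rewrite ge_max lerDr xn (le_trans l) // lerDl.
Unshelve. all: by end_near. Qed.

Context {Y : nat -> R -> R}.
Hypothesis phi_cvg : forall i, (1 <= i <= m)%N ->
  {uniform `[0, 1], phi m i @ \oo --> Y i}.
Hypothesis Y_cont : forall i, (1 <= i <= m)%N -> {within `[0, 1], continuous (Y i)}.

Lemma cvg_first_nice (k : nat -> nat) s (x : R) : (s < m)%N ->
    (\forall n \near \oo, (1 <= k n <= n)%N) -> 0 <= x <= 1 ->
    (fun n => (k n)%:R / n%:R : R) @ \oo --> x ->
  (fun n => F n (k n) s) @ \oo --> Y (m - s) x.
Proof.
move=> sm kn x01 kx; have im : (1 <= m - s <= m)%N by lia.
have bnd n : (1 <= k n <= n)%N -> 0 <= ((k n)%:R / n%:R : R) <= 1.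
  move=> h; have nR : 0 < n%:R :> R by rewrite ltr0n; lia.
  by rewrite divr_ge0 //= ler_pdivrMr // mul1r ler_nat; case/andP: h.
have := @uniform_cvg_at R (phi m (m - s)) (Y (m - s)) _ _ x (phi_cvg im) (Y_cont im) _ _ kx.
have -> : `[0, 1]%classic x = true :> Prop by rewrite /= in_itv /= x01.
move=> /(_ isT) h; apply: cvg_trans (h _); last first.
  by apply: filterS kn => n /bnd; rewrite /= in_itv.
apply: near_eq_cvg; apply: filterS2 near_pos kn => n n0 kn'.
rewrite phiE ?bnd // scaled_level_nat //.
by congr (F n _ _); lia.
Qed.



Lemma Y_end : Y m 1 = 0.
Proof.
have h := @cvg_first_nice id 0 1 (ltnW m2) _ _ _.
rewrite subn0 in h; apply/esym; apply: (cvg_unique _ _ (h _ _ _)) => //.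
- apply: (cvg_trans _ (@cvg_cst _ _ _ _ _ : (fun=> 0 : R) @ \oo --> (0 : R))).
  apply: near_eq_cvg; apply: filterS near_pos => n n0.
  by rewrite (first_nice_balanced m2 n0).1.
- by apply: filterS near_pos => n n0; rewrite leqnn andbT.
- by rewrite ler01 lexx.
apply: (cvg_trans _ (@cvg_cst _ _ _ _ _ : (fun=> 1 : R) @ \oo --> (1 : R))).
apply: near_eq_cvg; apply: filterS near_pos => n n0.
by rewrite divff // pnatr_eq0 -lt0n.
Qed.

(** Keeps 0 from being a fixed point and starts the intermediate value argument; a rule that is
    still at level 1 does not lose its chance as [n] grows. *)
Lemma Y0_gt0 : 0 < Y m 0.
Proof.
have h := @cvg_first_nice (fun=> 1%N) 0 0 (ltnW m2) _ _ _.
have {}h : (fun n => F n 1 0) @ \oo --> Y m 0.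
  rewrite subn0 in h; apply: h.
  - exact: near_pos.
  - by rewrite lexx ler01.
  by under eq_fun do rewrite mul1r; exact: cvg_invn.
(* With n = 3 K the bound of [balanced_early_ge] equals (1 - 1 / K) / 6, which is at least 1 / 9 for
   K >= 3 and so exceeds 1 / 18. *)
have h3 : (fun K => F (3 * K.+3)%N 1 0) @ \oo --> Y m 0.
  apply: (cvg_comp (fun K => (3 * K.+3)%N) (fun n => F n 1 0) _ h).
  by move=> A [N _ NA]; exists N => // n /= Nn; apply: NA => /=; lia.
apply: (@lt_le_trans _ _ (18%:R^-1)); first by rewrite invr_gt0.
apply: (ler_cvg_to (cvg_cst _) h3); near=> j.
set K := j.+3; set n := (3 * K)%N.
have n1 : (0 < n)%N by rewrite /n /K; lia.
have Xge k : (1 <= k <= n)%N -> k%:R / n%:R <= k%:R / n%:R :> R by [].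
have := balanced_early_ge m2 n1 (first_nice_balanced m2 n1) Xge
   (K := K) (k := 1) (r := 0).
move=> /(_ isT _ (ltnW m2)) h'; apply: le_trans (h' _); last by rewrite /n /K; lia.
have KR : 3 <= K%:R :> R by rewrite (ler_nat _ 3 K).
have K0 : 0 < K%:R :> R by apply: lt_le_trans KR.
rewrite /n natrM eqxx.
have -> : K%:R / (3 * K%:R) * (1 - 1 * (1 / K%:R) - (K%:R - 1) / (3 * K%:R - K%:R)) =
   (1 - K%:R^-1) / 6 :> R.
  by field; rewrite !gt_eqF // -{2}[K%:R]mul1r -mulrBl mulr_gt0 //; lra.
have : K%:R^-1 <= 3^-1 :> R by rewrite lef_pV2 ?posrE.
lra.
Unshelve. all: by end_near. Qed.

(** Limit of [exhausted_ratio_drop], multiplied by [n], at the levels of [x] and [y]. *)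
Lemma Y_ratio_drop x y : 0 < x < y -> y <= 1 ->
  (y - x) / y <= Y m x / x - Y m y / y.
Proof.
move=> /andP[x0 xy] y1; have y0 : 0 < y by apply: lt_trans xy.
have x01 : 0 <= x <= 1 by rewrite ltW //= (le_trans (ltW xy)).
have y01 : 0 <= y <= 1 by rewrite ltW.
have lk := cvg_scaled_level x01; have ll := cvg_scaled_level y01.
have lev v : 0 <= v <= 1 -> (fun n => F n (scaled_level n v) 0) @ \oo --> Y m v.
  move=> v01; have := @cvg_first_nice (scaled_level^~ v) 0 v (ltnW m2) _ v01 (cvg_scaled_level v01).
  by rewrite subn0; apply; apply: filterS near_pos => n n0; exact: scaled_level_bounds.
apply: (@ler_cvg_to _ \oo _ R
  (fun n => ((scaled_level n y)%:R / n%:R - (scaled_level n x)%:R / n%:R) / ((scaled_level n y)%:R / n%:R))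
  (fun n => F n (scaled_level n x) 0 / ((scaled_level n x)%:R / n%:R)
          - F n (scaled_level n y) 0 / ((scaled_level n y)%:R / n%:R))).
- by apply: cvgM; [exact: cvgB|apply: cvgV => //; rewrite gt_eqF].
- apply: cvgB; apply: cvgM; [exact: lev|apply: cvgV => //; rewrite gt_eqF //|exact: lev|apply: cvgV => //; rewrite gt_eqF //].
near=> n.
have n0 : (0 < n)%N by near: n; exact: near_pos.
have Xge k : (1 <= k <= n)%N -> k%:R / n%:R <= k%:R / n%:R :> R by [].
have /andP[k1 kn] := scaled_level_bounds n0 x01.
have /andP[l1 ln] := scaled_level_bounds n0 y01.
have kl := le_scaled_level n (ltW xy).
have := exhausted_ratio_drop m2 n0 (first_nice_balanced m2 n0) Xge k1 (l := scaled_level n y).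
rewrite kl ln => /(_ isT).
set k := scaled_level n x in k1 *; set l := scaled_level n y in l1 *.
have nR : 0 < n%:R :> R by rewrite ltr0n.
have kR : 0 < k%:R :> R by rewrite ltr0n.
have lR : 0 < l%:R :> R by rewrite ltr0n.
rewrite -(ler_pM2r nR) => h.
have -> : (l%:R / n%:R - k%:R / n%:R) / (l%:R / n%:R) = (l%:R - k%:R) / (l%:R * n%:R) * n%:R :> R.
  by field; rewrite !gt_eqF.
apply: le_trans h _; rewrite le_eqVlt; apply/orP; left; apply/eqP.
by field; rewrite !gt_eqF.
Unshelve. all: by end_near. Qed.

Lemma fixpoint_exists : exists2 t, 0 < t < 1 & Y m t = t.
Proof.
have mm : (1 <= m <= m)%N by lia.
have cont : {within `[0, 1], continuous (fun x => Y m x - x)}.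
  apply: within_continuousB; first exact: Y_cont.
  by apply: continuous_subspaceT => x; exact: cvg_id.
have := @IVT R (fun x => Y m x - x) 0 1 0 ler01 cont.
rewrite Y_end subr0 sub0r => /(_ _)[].
  by rewrite ge_min le_max (ltW Y0_gt0) lerN10 orbT.
move=> t; rewrite in_itv /= => /andP[t0 t1] /eqP; rewrite subr_eq0 => /eqP e.
exists t => //; rewrite !lt_neqAle t0 t1 !andbT; apply/andP; split.
  by apply: contraTneq Y0_gt0 => ->; rewrite e ltxx.
by apply: contra_eqN e => /eqP ->; rewrite Y_end eq_sym oner_eq0.
Qed.

Lemma fixpoint_side t x : 0 < t < 1 -> Y m t = t -> 0 < x <= 1 ->
  (x < t -> x < Y m x) /\ (t < x -> Y m x < x).
Proof.
move=> /andP[t0 t1] e /andP[x0 x1]; split => h.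
  have := @Y_ratio_drop x t; rewrite x0 h e divff ?gt_eqF // => /(_ isT (ltW t1)) H.
  have : 1 < Y m x / x.
    by rewrite -subr_gt0; apply: lt_le_trans H; rewrite divr_gt0 // subr_gt0.
  by rewrite ltr_pdivlMr // mul1r.
have := @Y_ratio_drop t x; rewrite t0 h e divff ?gt_eqF // => /(_ isT x1) H.
have : Y m x / x < 1.
  by rewrite -subr_gt0; apply: lt_le_trans H; rewrite divr_gt0 // subr_gt0.
by rewrite ltr_pdivrMr // mul1r.
Qed.

Lemma fixpoint_unique t : 0 < t < 1 -> Y m t = t ->
  unique (fun x => 0 <= x <= 1 /\ Y m x = x) t.
Proof.
move=> t01 e; split; first by case/andP: t01 => /ltW -> /ltW ->.
move=> x [/andP[x0 x1] ex].
(* The comparison of ratios needs x > 0; the point 0 is excluded by [Y0_gt0]. *)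
have xn0 : 0 < x.
  rewrite lt_neqAle x0 andbT; apply/eqP => e0.
  by move: Y0_gt0; rewrite e0 ex ltxx.
have [h1 h2] := fixpoint_side t01 e (introT andP (conj xn0 x1)).
have [h|h|//] := ltgtP t x.
  by have := h2 h; rewrite ex ltxx.
by have := h1 h; rewrite ex ltxx.
Qed.

End Limits.

(** * Convergence of the threshold and of the law on reaching it *)

Section Conclusion.
Context {R : realType} (m : nat) {Y : nat -> R -> R}.
Hypothesis m2 : (2 <= m)%N.
Hypothesis phi_cvg : forall i, (1 <= i <= m)%N ->
  {uniform `[0, 1], phi m i @ \oo --> Y i}.
Hypothesis Y_cont : forall i, (1 <= i <= m)%N -> {within `[0, 1], continuous (Y i)}.

Local Notation F n := (first_nice_value (R := R) m n).

Context {t : R} (t01 : 0 < t < 1) (Yt : Y m t = t).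
Context {K : nat -> nat}.
Hypothesis K_bounds : forall n, (0 < n)%N -> (1 <= K n <= n)%N.

(** For large [n], the sign of [Y m v - v] at v = t + e / 2 and at v = t - e / 2 decides on which
    side of [K n] the level of [v] lies. *)
Lemma cvg_threshold :
  (forall n k, (0 < n)%N -> (K n <= k <= n)%N -> F n k 0 <= k%:R / n%:R) ->
  (forall n k, (0 < n)%N -> (1 <= k < K n)%N -> k%:R / n%:R < F n k 0) ->
  (fun n => (K n)%:R / n%:R : R) @ \oo --> t.
Proof.
move=> Kabove Kbelow; have /andP[t0 t1] := t01.
apply/cvgrPdist_lt => e e0.
have e2 : 0 < e / 2 by rewrite divr_gt0.
have gap v : 0 < v <= 1 ->
   (fun n => F n (scaled_level n v) 0 - (scaled_level n v)%:R / n%:R) @ \oo --> Y m v - v.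
  move=> /andP[v0 v1]; have v01 : 0 <= v <= 1 by rewrite ltW.
  have := @cvg_first_nice _ _ m2 _ phi_cvg Y_cont (scaled_level^~ v) 0 v (ltnW m2) _ v01 (cvg_scaled_level v01).
  rewrite subn0 => h; apply: cvgB; last exact: cvg_scaled_level.
  by apply: h; apply: filterS near_pos => n n0; exact: scaled_level_bounds.
have upper : \forall n \near \oo, (K n)%:R / n%:R < t + e :> R.
  (* When t + e / 2 lies outside the range of levels, K n <= n already gives the bound. *)
  have [h|h] := leP 1 (t + e / 2).
    apply: filterS near_pos => n n0.
    have nR : 0 < n%:R :> R by rewrite ltr0n.
    apply: (@le_lt_trans _ _ 1); last by lra.
    by rewrite ler_pdivrMr // mul1r ler_nat; case/andP: (K_bounds n0).
  set v := t + e / 2 in h.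
  have v01 : 0 < v <= 1 by rewrite (ltW h) addr_gt0.
  have tv : t < v by rewrite ltrDl.
  have Yv : Y m v - v < 0.
    by rewrite subr_lt0; apply: (fixpoint_side m2 phi_cvg Y_cont t01 Yt v01).2.
  have v01' : 0 <= v <= 1 by case/andP: v01 => /ltW -> ->.
  have vc := cvg_scaled_level v01'.
  near=> n.
  have n0 : (0 < n)%N by near: n; exact: near_pos.
  have Fn : F n (scaled_level n v) 0 - (scaled_level n v)%:R / n%:R < 0.
    by near: n; apply: (cvgr_lt _ (gap _ v01)).
  have ln : (scaled_level n v)%:R / n%:R < t + e :> R.
    by near: n; apply: (cvgr_lt _ vc); rewrite /v; lra.
  have /andP[l1 _] := scaled_level_bounds n0 v01'.
  apply: le_lt_trans ln; rewrite ler_pM2r ?invr_gt0 ?ltr0n // ler_nat leqNgt.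
  apply/negP => lK; have := Kbelow n (scaled_level n v) n0; rewrite l1 lK => /(_ isT).
  by rewrite ltNge => /negP; apply; rewrite -subr_le0 ltW.
have lower : \forall n \near \oo, t - e < (K n)%:R / n%:R :> R.
  have [h|h] := leP (t - e / 2) 0.
    apply: filterS near_pos => n n0.
    by apply: (@lt_le_trans _ _ 0); [lra|rewrite divr_ge0].
  set v := t - e / 2 in h.
  have vt : v < t by rewrite gtrBl.
  have v01 : 0 < v <= 1 by rewrite h (le_trans (ltW vt)) // ltW.
  have Yv : 0 < Y m v - v.
    by rewrite subr_gt0; apply: (fixpoint_side m2 phi_cvg Y_cont t01 Yt v01).1.
  have v01' : 0 <= v <= 1 by case/andP: v01 => /ltW -> ->.
  have vc := cvg_scaled_level v01'.
  near=> n.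
  have n0 : (0 < n)%N by near: n; exact: near_pos.
  have Fn : 0 < F n (scaled_level n v) 0 - (scaled_level n v)%:R / n%:R.
    by near: n; apply: (cvgr_gt _ (gap _ v01)).
  have ln : t - e < (scaled_level n v)%:R / n%:R :> R.
    by near: n; apply: (cvgr_gt _ vc); rewrite /v; lra.
  have /andP[l1 lN] := scaled_level_bounds n0 v01'.
  apply: lt_le_trans ln _; rewrite ler_pM2r ?invr_gt0 ?ltr0n // ler_nat leqNgt.
  apply/negP => lK; have := Kabove n (scaled_level n v) n0; rewrite (ltnW lK) lN => /(_ isT).
  by rewrite leNgt => /negP; apply; rewrite -subr_gt0.
apply: filterS2 upper lower => n u l; rewrite ltr_distlC.
by rewrite l u.
Unshelve. all: by end_near. Qed.

Hypothesis K_cvg : (fun n => (K n)%:R / n%:R : R) @ \oo --> t.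

(** The product is squeezed by [prod_ratio_bounds] with p = q / m, and n / K n tends to 1 / t. *)
Lemma cvg_survival q : (q < m)%N ->
  (fun n => n%:R * survival (R := R) m n (K n) q 1) @ \oo --> (1 - t) `^ (q%:R / m%:R) / t.
Proof.
move=> qm; have /andP[t0 t1] := t01; set p : R := q%:R / m%:R.
have mR : 0 < m%:R :> R by rewrite ltr0n; lia.
have p01 : 0 <= p <= 1.
  by rewrite /p divr_ge0 // ler_pdivrMr // mul1r ler_nat ltnW.
pose P n : R := \prod_(1 <= j < K n) ((n%:R - j%:R) / (n%:R - j%:R + p)).
have cP : P @ \oo --> (1 - t) `^ p.
  apply: (@squeeze_cvgr _ _ _ _ (fun n => (1 - (K n)%:R / n%:R) `^ p)
     (fun n => (1 - (K n)%:R / n%:R + n%:R^-1) `^ p)); last 2 first.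
  - apply: cvg_powR; first by rewrite subr_gt0.
    by apply: cvgB => //; exact: cvg_cst.
  - apply: cvg_powR; first by rewrite subr_gt0.
    rewrite -[X in _ --> X]addr0; apply: cvgD; last exact: cvg_invn.
    by apply: cvgB => //; exact: cvg_cst.
  apply: filterS near_pos => n n0.
  have nR : n%:R != 0 :> R by rewrite pnatr_eq0 -lt0n.
  have := prod_ratio_bounds p01 (K_bounds n0).
  rewrite (_ : (n%:R - (K n)%:R) / n%:R = 1 - (K n)%:R / n%:R); last by field.
  by rewrite (_ : (n%:R - (K n)%:R + 1) / n%:R = 1 - (K n)%:R / n%:R + n%:R^-1); last by field.
have : (fun n => P n / ((K n)%:R / n%:R)) @ \oo --> (1 - t) `^ p / t.
  by apply: cvgM => //; apply: cvgV => //; rewrite gt_eqF.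
apply: cvg_trans; apply: near_eq_cvg; apply: filterS near_pos => n n0.
have nR : n%:R != 0 :> R by rewrite pnatr_eq0 -lt0n.
have KR : (K n)%:R != 0 :> R by rewrite pnatr_eq0 -lt0n; case/andP: (K_bounds n0).
rewrite /survival; suff -> : \prod_(1 <= j < K n)
    (m%:R * (n%:R - j%:R) / (m%:R * (n%:R - j%:R) + q%:R)) = P n.
  by field; rewrite nR KR.
apply: eq_big_nat.
move=> j /andP[_ jK].
have nj : 0 < n%:R - j%:R :> R.
  by rewrite subr_gt0 ltr_nat (leq_trans jK) //; case/andP: (K_bounds n0).
rewrite /p; field; rewrite (gt_eqF mR) /= gt_eqF //.
by apply: ltr_pwDl; rewrite ?mulr_gt0 ?ler0n.
Qed.

Lemma cvg_occupation s : (s < m)%N ->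
  (fun n => occupation (R := R) m n (K n) s) @ \oo --> z m (m - s) t.
Proof.
move=> sm; have /andP[t0 t1] := t01.
have mR : 0 < m%:R :> R by rewrite ltr0n; lia.
set y := (1 - t) `^ m%:R^-1.
have t1' : 0 < 1 - t by rewrite subr_gt0.
have y0 : 0 < y by exact: powR_gt0.
have yE j : (1 - t) `^ (j%:R / m%:R) = y ^+ j.
  by rewrite mulrC powRrM powR_mulrn // ltW.
have ym : 1 - t = y ^+ m by rewrite -yE divff ?gt_eqF // powRr1 // ltW.
have limit : z m (m - s) t = \sum_(q < m) (-1) ^+ (q + s) * 'C(q, s)%:R *
    ('C(m, q)%:R * (y ^+ q / t - y ^+ m / t)).
  rewrite z_binomial ?t01 //; last by lia.
  rewrite -/y subKn ?(ltnW sm) // bin_sub ?(ltnW sm) //.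
  (* The sum at 1 is subtracted from the sum at [y]: it vanishes because s < m, and it cancels the
     term q = m, which leaves the range q < m used in [occupation]. *)
  have E1 := @binomial_sum_alternating R y m s m.+1 (ltnSn m).
  have E2 := @binomial_sum_alternating R 1 m s m.+1 (ltnSn m).
  rewrite subrr expr0n (_ : (m - s == 0)%N = false) ?mulr0 in E2; last by lia.
  pose S (x : R) := \sum_(q < m.+1) 'C(m, q)%:R * ((-1) ^+ (q + s) * 'C(q, s)%:R * x ^+ q).
  transitivity (S y / t - S 1 * (y ^+ m / t)); first by rewrite /S E1 E2 mul0r subr0.
  rewrite /S !mulr_suml -sumrB.
  rewrite big_ord_recr /= [X in _ + X](_ : _ = 0) ?addr0; last by rewrite expr1n; ring.
  by apply: eq_bigr => q _; rewrite expr1n; ring.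
rewrite limit.
apply: cvg_big => [|q _]; first by move=> x; exact: add_continuous.
apply: cvgMr.
have : (fun n => 'C(m, q)%:R * (n%:R * survival (R := R) m n (K n) q 1
     - ((1 - (K n)%:R / n%:R) + (q%:R / m%:R) * n%:R^-1) / ((K n)%:R / n%:R))) @ \oo -->
   'C(m, q)%:R * (y ^+ q / t - y ^+ m / t).
  apply: cvgMr; apply: cvgB; first by rewrite -yE; exact: cvg_survival.
  apply: cvgM; last by apply: cvgV => //; rewrite gt_eqF.
  rewrite -ym -[X in _ --> X]addr0; apply: cvgD.
    by apply: cvgB => //; exact: cvg_cst.
  by rewrite -[X in _ --> X](mulr0 (q%:R / m%:R)); apply: cvgMr; exact: cvg_invn.
apply: cvg_trans; apply: near_eq_cvg; apply: filterS near_pos => n n0.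
have nR : n%:R != 0 :> R by rewrite pnatr_eq0 -lt0n.
have KR : (K n)%:R != 0 :> R by rewrite pnatr_eq0 -lt0n; case/andP: (K_bounds n0).
rewrite moment_start ?K_bounds //; congr (_ * (_ - _)).
by field; rewrite nR KR gt_eqF.
Qed.

End Conclusion.

(** * Limit of the optimal success probability *)

Theorem theorem3 (R : realType) (m : nat) (Y : nat -> R -> R)
  (hm : (2 <= m)%N)
  (hphi : forall i : nat, (1 <= i <= m)%N ->
     [/\ {uniform `[0%R, 1%R], phi m i @ \oo --> Y i},
         {within `[0%R, 1%R], continuous (Y i)} &
         differentiable_on `]0%R, 1%R] (Y i)])
  (htheta : forall i : nat, (1 <= i <= m)%N ->
     exists T : R -> R,
       [/\ {uniform `[0%R, 1%R], theta m i @ \oo --> T},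
           {within `[0%R, 1%R[, continuous T} &
           differentiable_on `[0%R, 1%R[ T]) :
  exists2 vartheta : R,
    unique (fun x => 0 <= x <= 1 /\ Y m x = x) vartheta &
    (fun n : nat => optimal_success R m n) @ \oo --> pi_sum m Y vartheta.
Proof.
have phi_cvg i : (1 <= i <= m)%N -> {uniform `[0, 1], phi m i @ \oo --> Y i}.
  by case/hphi.
have Y_cont i : (1 <= i <= m)%N -> {within `[0, 1], continuous (Y i)}.
  by case/hphi.
have [t t01 Yt] := fixpoint_exists hm phi_cvg Y_cont.
exists t; first exact: (fixpoint_unique hm phi_cvg Y_cont).
have exK : forall n : nat, exists K, (0 < n)%N ->
   [/\ (1 <= K <= n)%N,
      forall k, (K <= k <= n)%N -> first_nice_value (R := R) m n k 0 <= k%:R / n%:R,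
      forall k, (1 <= k < K)%N -> k%:R / n%:R < first_nice_value (R := R) m n k 0 &
      optimal_value (R := R) m n 1 m.-1 =
        \sum_(s < m) occupation (R := R) m n K s * first_nice_value (R := R) m n K s].
  move=> n; have [n0|n0] := posnP n; first by exists 0%N; rewrite n0.
  by have [k kP] := @threshold_exists R m n hm n0; exists k.
have [K KP] := choice exK.
have K_bounds n : (0 < n)%N -> (1 <= K n <= n)%N by case/KP.
have K_cvg : (fun n => (K n)%:R / n%:R : R) @ \oo --> t.
  apply: (cvg_threshold hm phi_cvg Y_cont t01 Yt K_bounds) => n k n0.
    by case: (KP _ n0) => _ h _ _; exact: h.
  by case: (KP _ n0) => _ _ h _; exact: h.
(* The reversal i = m - s passes from copies inspected to copies still to come. *)
have -> : pi_sum m Y t = \sum_(s < m) z m (m - s) t * Y (m - s)%N t.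
  rewrite /pi_sum big_add1 /= big_mkord (reindex_inj rev_ord_inj) /=.
  by apply: eq_bigr => s _; rewrite -subSn // subSS mulrC.
have : (fun n => \sum_(s < m) occupation (R := R) m n (K n) s *
    first_nice_value m n (K n) s) @ \oo --> \sum_(s < m) z m (m - s) t * Y (m - s)%N t.
  apply: cvg_big => [|s _]; first by move=> x; exact: add_continuous.
  apply: cvgM; first exact: (cvg_occupation hm t01 K_bounds K_cvg).
  apply: (cvg_first_nice hm phi_cvg Y_cont) => //.
    by apply: filterS near_pos => n; exact: K_bounds.
  by case/andP: t01 => /ltW -> /ltW ->.
apply: cvg_trans; apply: near_eq_cvg; apply: filterS near_pos => n n0.
by rewrite optimal_success_value //; case: (KP _ n0).
Qed.
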